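(* Let $u_0\in C_0(\bar\Omega)$ and let $u\in C_b(\bar\Omega\times[0,\infty))$ be a solution of the Dirichlet problem with zero boundary data, i.e. $\partial_t u=K_0(u)$ in $\Omega\times(0,\infty)$ and $u(\cdot,0)=u_0$ in $\Omega$. Let $\eta>0$. Then the following estimates hold. - If $\lambda(\eta)<1$, then for any $t>0$, $$\omega(\eta,t)\le\Big(\omega_0(\eta)+\gamma(\eta)\,\|u_0\|_\infty\,\frac{e^{(1-\lambda(\eta))t}-1}{1-\lambda(\eta)}\Big)e^{(\lambda(\eta)-1)t}.$$ - If $\lambda(\eta)=1$, then for any $t>0$, $$\omega(\eta,t)\le\omega_0(\eta)+\gamma(\eta)\,\|u_0\|_\infty\,t.$$
   Context: $\Omega\subset\mathbb{R}^n$ is open, bounded, connected and regular (i.e. with smooth boundary). $\mu\in L^1(\mathbb{R}^n)$ is a nonnegative function with $\int_{\mathbb{R}^n}\mu(z)\,dz=1$; the symbol $\mu$ also denotes the measure $d\mu(z)=\mu(z)\,dz$. $C_0(\bar\Omega)$ denotes the continuous functions on $\bar\Omega$ that vanish on $\partial\Omega$; $C_b$ denotes bounded continuous functions. The nonlocal operator with zero boundary data is $$K_0(u)(x,t)=\int_{\{z:\,x+z\in\Omega\}}u(x+z,t)\,d\mu(z)-u(x,t),$$ and the equation $\partial_t u=K_0(u)$ is understood in the sense of distributions in $\Omega\times(0,\infty)$. For $x\in\mathbb{R}^n$ let $\tau_x^{-1}\Omega=\{z\in\mathbb{R}^n:\ x+z\in\Omega\}$, and for sets $A,B$ let $A\,\Delta\,B=(A\setminus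 B)\cup(B\setminus A)$. For $\eta>0$ define $$\lambda(\eta)=\sup_{x,y\in\Omega,\ |x-y|<\eta}\mu\big(\tau_x^{-1}\Omega\cap\tau_y^{-1}\Omega\big),\qquad \gamma(\eta)=\sup_{x,y\in\Omega,\ |x-y|<\eta}\mu\big(\tau_x^{-1}\Omega\,\Delta\,\tau_y^{-1}\Omega\big),$$ $$\omega(\eta,t)=\sup_{x,y\in\Omega,\ |x-y|<\eta}|u(x,t)-u(y,t)|,\qquad \omega_0(\eta)=\sup_{x,y\in\Omega,\ |x-y|<\eta}|u_0(x)-u_0(y)|.$$ $\|u_0\|_\infty$ is the supremum norm of $u_0$. *)

(* Defs.v *)
From HB Require Import structures.
From mathcomp Require Import all_boot all_order all_algebra.
From mathcomp Require Import all_classical all_reals all_analysis measurable_realfun.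

Set Implicit Arguments.
Unset Strict Implicit.
Unset Printing Implicit Defensive.
Import Order.TTheory GRing.Theory Num.Theory.
Import numFieldNormedType.Exports.
Local Open Scope classical_set_scope.
Local Open Scope ring_scope.

(* Borel sets of R^n = 'rV[R]_n. *)
HB.instance Definition _ (R : realType) (n : nat) :=
  Measurable.copy 'rV[R]_n (g_sigma_algebraType (@open 'rV[R]_n)).

Lemma measurable_rV (R : realType) d (T : measurableType d) n
    (f : T -> 'rV[R]_n) :
  (forall i, measurable_fun setT (fun t => f t ord0 i)) ->
  measurable_fun setT f.
Proof.
move=> mf; apply: (measurability (@open 'rV[R]_n)) => // _ [A oA <-].
rewrite setTI.
pose B (p : 'rV[rat]_n * rat) := [set x : 'rV[R]_n |
  forall i, ball (ratr (p.1 ord0 i) : R) (ratr p.2) (x ord0 i)].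
pose F p := if `[< B p `<=` A >] then B p else set0.
have -> : A = \bigcup_p F p.
  apply/seteqP; split=> [x Ax|x [p _]]; last first.
    by rewrite /F; case: asboolP => // BA; exact: BA.
  have /nbhs_ballP[e /= e0 xeA] : nbhs x A by exact: open_nbhs_nbhs.
  have [r] : exists r : rat, (ratr r : R) \in `]0, (e / 2)%R[.
    by apply/rat_in_itvoo; rewrite divr_gt0.
  rewrite in_itv/= => /andP[r0 re].
  have /choice[q qP] (i : 'I_n) : exists q : rat,
      ball (ratr q : R) (ratr r) (x ord0 i).
    have [q] : exists q : rat,
        ratr q \in `](x ord0 i - ratr r)%R, (x ord0 i + ratr r)%R[.
      by apply/rat_in_itvoo; rewrite ltrBlDr -addrA ltrDl addr_gt0.
    rewrite in_itv/= => qx; exists q.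
    by apply: ball_sym; rewrite -ball_normE/= distrC ltr_distl.
  exists (\row_i q i, r) => //; rewrite /F; case: asboolP => [_ i|].
    by rewrite mxE; exact: qP.
  case=> y By; apply: xeA; split=> // i j; rewrite ord1.
  rewrite [e]splitr; apply: (@ball_triangle _ _ (ratr (q j) : R)).
    by apply/ball_sym/(le_ball (ltW re)); exact: qP.
  by apply/(le_ball (ltW re)); have := By j; rewrite mxE.
rewrite preimage_bigcup; apply: countable_bigcupT_measurable => // p.
rewrite /F; case: ifP => _; last by rewrite preimage_set0.
rewrite [X in measurable X](_ : _ = \bigcap_(i in [set: 'I_n])
    (fun t => f t ord0 i) @^-1` ball (ratr (p.1 ord0 i) : R) (ratr p.2)).
  apply: fin_bigcap_measurable => // i _.
  rewrite -[X in measurable X]setTI; apply: mf => //.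
  by apply: open_measurable; exact: ball_open.
by apply/seteqP; split=> [t Bt i _|t Bt i]; [exact: Bt|exact: Bt].
Qed.

Definition consrV (R : realType) n (p : measurableTypeR R * 'rV[R]_n) :
    'rV[R]_n.+1 :=
  \row_i (if unlift ord0 i is Some j then p.2 ord0 j else p.1).

Lemma consrV0 (R : realType) n (p : R * 'rV[R]_n) : consrV p ord0 ord0 = p.1.
Proof. by rewrite mxE unlift_none. Qed.

Lemma consrVS (R : realType) n (p : R * 'rV[R]_n) j :
  consrV p ord0 (lift ord0 j) = p.2 ord0 j.
Proof. by rewrite mxE liftK. Qed.

Lemma measurable_coord (R : realType) n (i : 'I_n) :
  measurable_fun [set: 'rV[R]_n] (fun x => x ord0 i).
Proof.
apply: (measurability _ (RGenOpens.measurableE R)) => _ [_ [a [b ->]] <-].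
rewrite setTI; apply: sub_gen_smallest.
apply: open_comp => [x _|]; [exact: coord_continuous|exact: interval_open].
Qed.

Lemma measurable_consrV (R : realType) n : measurable_fun setT (@consrV R n).
Proof.
apply: measurable_rV => i; have [j ->|->] := unliftP ord0 i.
  apply: (eq_measurable_fun ((fun x : 'rV[R]_n => x ord0 j) \o snd)).
    by move=> p _; rewrite consrVS.
  by apply: measurableT_comp; [exact: measurable_coord|exact: measurable_snd].
apply: (eq_measurable_fun fst) => [p _|]; first by rewrite consrV0.
exact: measurable_fst.
Qed.

(* Lebesgue measure on R^n, by iterated products R^(n+1) = R x R^n; lebesgue_rV_box
   below gives its value on products of Borel sets. *)
Section lebesgueS.
Context (R : realType) (n : nat).
Variable m : {sigma_finite_measure set 'rV[R]_n -> \bar R}.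

Definition lebesgueS : set 'rV[R]_n.+1 -> \bar R :=
  pushforward (@lebesgue_measure R \x m)%E (@consrV R n).

Let lebesgueS_measure : {measure set 'rV[R]_n.+1 -> \bar R} :=
  measure_function_pushforward__canonical__measure_function_Measure
    (@lebesgue_measure R \x m)%E (@measurable_consrV R n).

HB.instance Definition _ := isMeasure.Build _ _ _ lebesgueS
  (measure0 lebesgueS_measure) (measure_ge0 lebesgueS_measure)
  (@measure_semi_sigma_additive _ _ _ lebesgueS_measure).

Let lebesgueS_sigma_finite : sigma_finite setT lebesgueS.
Proof.
have /sigma_finiteP[F [FT ndF Ffin]] := sigma_finiteT (@lebesgue_measure R).
have /sigma_finiteP[G [GT ndG Gfin]] := sigma_finiteT m.
pose tl (x : 'rV[R]_n.+1) : 'rV[R]_n := \row_j x ord0 (lift ord0 j).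
have mtl : measurable_fun setT tl.
  apply: measurable_rV => j.
  apply: (eq_measurable_fun (fun x : 'rV[R]_n.+1 => x ord0 (lift ord0 j))).
    by move=> x _; rewrite /= mxE.
  exact: measurable_coord.
exists (fun k => (fun x : 'rV[R]_n.+1 => x ord0 ord0) @^-1` F k `&` tl @^-1` G k).
  apply/esym; rewrite -subTset => x _.
  have [i _ Fi] : (\bigcup_i F i) (x ord0 ord0) by rewrite -FT.
  have [j _ Gj] : (\bigcup_i G i) (tl x) by rewrite -GT.
  exists (maxn i j) => //; split.
    by have /subsetPset := ndF _ _ (leq_maxl i j); exact.
  by have /subsetPset := ndG _ _ (leq_maxr i j); exact.
move=> k; have [mF Foo] := Ffin k; have [mG Goo] := Gfin k; split.
  apply: measurableI; rewrite -[X in measurable X]setTI.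
    exact: measurable_coord.
  exact: mtl.
rewrite /lebesgueS /pushforward.
rewrite (_ : _ @^-1` _ = F k `*` G k).
  by rewrite product_measure1E// lte_mul_pinfty// ge0_fin_numE.
have tlK p : tl (consrV p) = p.2 by apply/rowP => j; rewrite mxE consrVS.
by apply/seteqP; split=> p /=; rewrite consrV0 tlK.
Qed.

HB.instance Definition _ := Measure_isSigmaFinite.Build _ _ _ lebesgueS
  lebesgueS_sigma_finite.

End lebesgueS.

Fixpoint lebesgue_rV (R : realType) (n : nat) :
    {sigma_finite_measure set 'rV[R]_n -> \bar R} :=
  match n return {sigma_finite_measure set 'rV[R]_n -> \bar R} with
  | 0 => @dirac _ 'rV[R]_0 0 R
  | n'.+1 => lebesgueS (lebesgue_rV R n')
  end.

Lemma measurable_box (R : realType) n (A : 'I_n -> set R) :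
  (forall i, measurable (A i)) ->
  measurable [set x : 'rV[R]_n | forall i, A i (x ord0 i)].
Proof.
move=> mA; rewrite (_ : mkset _ =
    \bigcap_(i in [set: 'I_n]) (fun x : 'rV[R]_n => x ord0 i) @^-1` A i).
  apply: fin_bigcap_measurable => // i _.
  by rewrite -[X in measurable X]setTI; exact: measurable_coord.
by apply/seteqP; split=> [x Ax i _|x Ax i]; exact: Ax.
Qed.

Lemma lebesgue_rV_box (R : realType) n (A : 'I_n -> set R) :
  (forall i, measurable (A i)) ->
  lebesgue_rV R n [set x | forall i, A i (x ord0 i)] =
  (\prod_(i < n) lebesgue_measure (A i))%E.
Proof.
elim: n A => [|n IH] A mA.
  by rewrite big_ord0 /= diracE mem_set// => -[].
rewrite big_ord_recl -(IH (fun i => A (lift ord0 i)))//=.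
rewrite -product_measure1E; [|exact: mA|]; last first.
  exact: (measurable_box (fun j => mA (lift ord0 j))).
rewrite /lebesgueS /pushforward; congr (_ _).
apply/seteqP; split=> [p Ap|p [Ap0 Ap] i].
  split=> [|i] /=; first by have := Ap ord0; rewrite consrV0.
  by have := Ap (lift ord0 i); rewrite consrVS.
by have [j ->|->] := unliftP ord0 i; rewrite ?consrV0 ?consrVS.
Qed.

(* The library norm on 'rV[R]_n is the sup norm; this is the Euclidean one. *)
Definition enorm (R : realType) n (x : 'rV[R]_n) : R :=
  Num.sqrt (\sum_i x ord0 i ^+ 2).

Definition boundary (T : topologicalType) (A : set T) : set T :=
  closure A `\` A°.

(* In finite dimension the existence and continuity of all iterated directional
   derivatives of order at most k is the usual notion of C^k function. *)
Fixpoint Ck (R : realType) (V : normedModType R) (k : nat) (f : V -> R) : Prop :=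
  match k with
  | 0 => continuous f
  | k'.+1 => continuous f /\
      forall v, (forall x, derivable f x v) /\ Ck k' (fun x => 'D_v f x)
  end.

Definition smooth (R : realType) (V : normedModType R) (f : V -> R) : Prop :=
  forall k, Ck k f.

(* Near each boundary point, and up to the choice of a coordinate axis i and of
   its orientation s, Omega is the region strictly above the graph of a smooth
   function of the other coordinates. *)
Definition smooth_boundary (R : realType) n (Omega : set 'rV[R]_n) : Prop :=
  forall x0, boundary Omega x0 ->
    exists (i : 'I_n) (s : bool) (g : 'rV[R]_n.-1 -> R), smooth g /\
      \forall x \near x0,
        Omega x <-> 0 < (-1) ^+ s * (x ord0 i - g (col' i x)).

(* u and u0 are total functions: only their values on the closure of Omega (and,
   for u, at times t >= 0) matter. *)
Section nonlocal_dirichlet.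
Context (R : realType) (n : nat).
Variables (Omega : set 'rV[R]_n) (mu : 'rV[R]_n -> R).
Implicit Type u : 'rV[R]_n * R -> R.

Local Notation leb := (lebesgue_rV R n).

Definition density_measure (A : set 'rV[R]_n) : R := \int[leb]_(z in A) mu z.

(* tau_x^{-1} Omega *)
Definition translate (x : 'rV[R]_n) : set 'rV[R]_n :=
  [set z | Omega (x + z)].

Definition K0 u (p : 'rV[R]_n * R) : R :=
  (\int[leb]_(z in translate p.1) (u (p.1 + z, p.2) * mu z)) - u p.

Definition test_function (D : set ('rV[R]_n * R)) (phi : 'rV[R]_n * R -> R) :=
  let supp := closure [set p | phi p != 0] in
  [/\ smooth phi, compact supp & supp `<=` D].

(* d/dt u = K0 u in the sense of distributions in Omega x (0, +oo). *)
Definition K0_equation u : Prop :=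
  let D := Omega `*` `]0, +oo[ in
  forall phi, test_function D phi ->
    - (\int[(leb \x @lebesgue_measure R)%E]_(p in D) (u p * 'D_(0, 1) phi p)) =
    \int[(leb \x @lebesgue_measure R)%E]_(p in D) (K0 u p * phi p).

Definition C0_closure (u0 : 'rV[R]_n -> R) : Prop :=
  {within closure Omega, continuous u0} /\
  (forall x, boundary Omega x -> u0 x = 0).

Definition Cb_closure u : Prop :=
  let D := closure Omega `*` `[0, +oo[ in
  {within D, continuous u} /\ [bounded u p | p in D].

Definition dirichlet_solution (u0 : 'rV[R]_n -> R) u : Prop :=
  [/\ Cb_closure u, K0_equation u & forall x, Omega x -> u (x, 0) = u0 x].

Definition sup_close (eta : R) (F : 'rV[R]_n -> 'rV[R]_n -> R) : R :=
  sup [set F p.1 p.2 | p in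
    [set p | [/\ Omega p.1, Omega p.2 & enorm (p.1 - p.2) < eta]]].

Definition lambda (eta : R) : R :=
  sup_close eta (fun x y => density_measure (translate x `&` translate y)).

Definition gamma (eta : R) : R :=
  sup_close eta (fun x y => density_measure (translate x `+` translate y)).

Definition omega0 (u0 : 'rV[R]_n -> R) (eta : R) : R :=
  sup_close eta (fun x y => `|u0 x - u0 y|).

Definition omega u (eta t : R) : R := omega0 (fun x => u (x, t)) eta.

Definition supnorm (u0 : 'rV[R]_n -> R) : R := sup [set `|u0 x| | x in closure Omega].

End nonlocal_dirichlet.

(* Main.v *)
Require Import Defs.
From mathcomp Require Import all_boot all_order all_algebra.
From mathcomp Require Import all_classical all_reals all_analysis.
From mathcomp Require Import measurable_realfun lra ring.
Set Implicit Arguments.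
Unset Strict Implicit.
Unset Printing Implicit Defensive.
Import Order.TTheory GRing.Theory Num.Theory.
Import numFieldNormedType.Exports.
Local Open Scope classical_set_scope.
Local Open Scope ring_scope.

(** The proof is a comparison argument carried out inside the distributional
    formulation of the equation.

    For two points x, y of the domain and small translations xi, the function
    U(xi, t) = u(x + xi, t) - u(y + xi, t) satisfies, as a distribution,
    dU/dt = K0 u(x + xi, t) - K0 u(y + xi, t). The nonlocal parts are integrals
    over the two translated domains; on their overlap the integrand is a
    difference of values of u at points still as close as x and y, and on their
    symmetric difference it is a single value of u, bounded by the norm of u0
    through the maximum principle. Hence dU/dt <= l W(t) + g M - U whenever W
    bounds all such differences at time t, with l and g the two suprema of the
    measure of the overlap and of the symmetric difference (mu_average_sub_le).

    To pass from distributions to points (weak_comparison,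
    comparison_nonincreasing), this inequality is tested with the product of a
    smooth bump in xi and of exp(t) times a smoothed indicator of [t1, t2]. Since
    the inequality holds for all small xi at once and U is continuous,
    concentrating the test function shows that exp(t) (U - f)(0, t) is
    nonincreasing as soon as f' + f dominates l W + g M. The right-hand side
    enters through this upper bound alone, so the limit is taken on U only. The
    test functions have to be translated from the origin to x and to y, whence
    the translation invariance of Lebesgue measure (weak_formulation_at).

    The bound W is then found by an iteration (geometric_improvement). If all
    differences are at most w + D on (0, T), where w solves
    w' = (l - 1) w + g M and w(0) is the modulus of u0, then comparison with
    f = w + l D gives the bound w + (1 - exp(-T)) D, because l <= 1; repeating
    this drives D to 0 (modulus_bound). The same scheme with constant f proves
    the maximum principle (maximum_principle). The two estimates of the theorem
    are the explicit formulas for w when l < 1 and when l = 1. *)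

(** * Closure properties of C^k functions *)

Section Ck_closure.
Context (R : realType) (V : normedModType R).
Implicit Types (f g : V -> R) (k : nat).

Lemma CkW k f : Ck k.+1 f -> Ck k f.
Proof.
elim: k f => [f [cf _] //|k IH f [cf fD]]; split=> // v.
by have [df Df] := fD v; split=> //; exact: IH.
Qed.

Lemma Ck_continuous k f : Ck k f -> continuous f.
Proof. by case: k => [//|k []]. Qed.

Lemma Ck_cst k (c : R) : Ck k (fun _ : V => c).
Proof.
elim: k c => [c|k IH c]; first exact: cst_continuous.
split=> [|v]; first exact: cst_continuous.
split=> [x|]; first exact: derivable_cst.
rewrite [X in Ck _ X](_ : _ = fun _ => 0); first exact: IH.
by apply/funext => x; rewrite derive_cst.
Qed.

Lemma CkD k f g : Ck k f -> Ck k g -> Ck k (fun x => f x + g x).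
Proof.
elim: k f g => [f g cf cg x|k IH f g [cf fD] [cg gD]].
  by apply: continuousD; [exact: cf|exact: cg].
split=> [x|v]; first by apply: continuousD; [exact: cf|exact: cg].
have [df Df] := fD v; have [dg Dg] := gD v.
split=> [x|]; first exact: derivableD.
rewrite [X in Ck _ X](_ : _ = fun x => 'D_v f x + 'D_v g x); first exact: IH.
by apply/funext => x; rewrite deriveD.
Qed.

Lemma CkM k f g : Ck k f -> Ck k g -> Ck k (fun x => f x * g x).
Proof.
elim: k f g => [f g cf cg x|k IH f g fC gC].
  by apply: continuousM; [exact: cf|exact: cg].
split=> [x|v].
  by apply: continuousM; [exact: (Ck_continuous fC)|exact: (Ck_continuous gC)].
have [df Df] := fC.2 v; have [dg Dg] := gC.2 v.
split=> [x|]; first exact: derivableM.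
rewrite [X in Ck _ X](_ : _ = fun x => f x * 'D_v g x + g x * 'D_v f x).
  by apply: CkD; apply: IH => //; exact: CkW.
by apply/funext => x; rewrite deriveM.
Qed.

Lemma Ck_prod k (I : Type) (r : seq I) (F : I -> V -> R) :
  (forall i, Ck k (F i)) -> Ck k (fun x => \prod_(i <- r) F i x).
Proof.
move=> FC; elim: r => [|i r IH].
  rewrite [X in Ck _ X](_ : _ = fun _ => 1); first exact: Ck_cst.
  by apply/funext => x; rewrite big_nil.
rewrite [X in Ck _ X](_ : _ = fun x => F i x * \prod_(j <- r) F j x).
  exact: CkM.
by apply/funext => x; rewrite big_cons.
Qed.

Lemma CkV k f : (forall x, f x != 0) -> Ck k f -> Ck k (fun x => (f x)^-1).
Proof.
move=> f0; elim: k => [cf x|k IH fC].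
  by apply: continuousV; [exact: f0|exact: cf].
split=> [x|v]; first by apply: continuousV; [|exact: (Ck_continuous fC)].
have [df Df] := fC.2 v.
split=> [x|]; first exact: derivableV.
rewrite [X in Ck _ X](_ : _ = fun x => -1 * ((f x)^-1 * (f x)^-1) * 'D_v f x).
  apply: CkM => //; apply: CkM; first exact: Ck_cst.
  by apply: CkM; apply: IH; exact: CkW.
by apply/funext => x; rewrite deriveV// expr2 invfM mulN1r.
Qed.

End Ck_closure.

(** Composition is needed only with affine functions [l]: along a line, [f \o l]
    is [f] along a line, so directional derivatives of [f \o l] are those of
    [f] with no chain rule involved. *)
Section Ck_comp_affine.
Context (R : realType) (V : normedModType R) (l : V -> R) (c : V -> R).
Hypothesis lE : forall s x v, l (s *: v + x) = s * c v + l x.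

Lemma derive_comp_affine (f : R -> R) v x :
  'D_v (f \o l) x = 'D_(c v) f (l x).
Proof. by rewrite /derive /=; under eq_fun do rewrite lE. Qed.

Lemma derivable_comp_affine (f : R -> R) v x :
  derivable f (l x) (c v) -> derivable (f \o l) x v.
Proof. by rewrite /derivable /=; under eq_fun do rewrite -[_ *: c v]/(_ * c v) -lE. Qed.

Lemma Ck_comp_affine k (f : R -> R) :
  continuous l -> Ck k f -> Ck k (f \o l).
Proof.
move=> cl; elim: k f => [f cf x|k IH f fC].
  by apply: continuous_comp; [exact: cl|exact: cf].
split=> [x|v].
  by apply: continuous_comp; [exact: cl|exact: (Ck_continuous fC)].
have [df Df] := fC.2 (c v); split=> [x|]; first exact: derivable_comp_affine.
rewrite [X in Ck _ X](_ : _ = (fun y => 'D_(c v) f y) \o l); first exact: IH.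
by apply/funext => x; rewrite /= derive_comp_affine.
Qed.

End Ck_comp_affine.

Lemma is_derive_continuous (R : realType) (f df : R -> R) :
  (forall x : R, is_derive x 1 f (df x)) -> continuous f.
Proof.
move=> fD x; apply/differentiable_continuous/derivable1_diffP.
by have [] := fD x.
Qed.

Lemma derivableV1 (R : realType) (f : R -> R) (x v : R) :
  derivable f x 1 -> derivable f x v /\ 'D_v f x = v * 'D_1 f x.
Proof.
move=> /derivable1_diffP df; split; first exact: diff_derivable.
by rewrite !deriveE// -[in LHS](mulr1 v) -[v * 1]/(v *: 1) linearZ.
Qed.

Lemma Ck_S1 (R : realType) k (f df : R -> R) :
  (forall x : R, is_derive x 1 f (df x)) -> Ck k df -> Ck k.+1 f.
Proof.
move=> fD dfC; have dv (x : R) : derivable f x 1 by have [] := fD x.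
split=> [|v]; first exact: is_derive_continuous fD.
split=> [x|]; first exact: (derivableV1 v (dv x)).1.
rewrite [X in Ck _ X](_ : _ = fun x => v * df x).
  by apply: CkM => //; exact: Ck_cst.
by apply/funext => x; rewrite (derivableV1 v (dv x)).2 derive_val.
Qed.

Lemma smooth_expR (R : realType) : smooth (@expR R).
Proof.
elim=> [|k IH]; first exact: continuous_expR.
by apply: Ck_S1 IH => x; exact: is_derive_expR.
Qed.

(** * A smooth step and a smooth bump on the line *)

Section flat.
Context (R : realType).

(** The classical flat function is [flat 0], that is [exp (- 1 / x)] for
    positive [x]. The whole family is needed because its linear span is closed
    under differentiation, which turns smoothness into an induction. *)
Definition flat (m : nat) (x : R) : R :=
  if 0 < x then x ^- m * expR (- x^-1) else 0.

Lemma flat_le0 m (x : R) : x <= 0 -> flat m x = 0.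
Proof. by rewrite /flat leNgt; case: ltP. Qed.

Lemma flat_ge0 m (x : R) : 0 <= flat m x.
Proof.
rewrite /flat; case: ltP => // x0.
by rewrite mulr_ge0 ?expR_ge0// invr_ge0 exprn_ge0 ?ltW.
Qed.

Lemma flat_gt0 m (x : R) : 0 < x -> 0 < flat m x.
Proof. by move=> x0; rewrite /flat x0 mulr_gt0 ?expR_gt0// invr_gt0 exprn_gt0. Qed.

Lemma flat0_le1 (x : R) : flat 0 x <= 1.
Proof.
rewrite /flat; case: ltP => // x0.
by rewrite expr0 invr1 mul1r expR_le1 oppr_le0 invr_ge0 ltW.
Qed.

(** Quadratic vanishing at the origin is what makes every [flat m]
    differentiable there; it follows from [y ^ (m + 2) / (m + 2)! <= exp y] at
    [y = 1 / x]. *)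
Lemma flat_bound m (x : R) : `|flat m x| <= m.+2`!%:R * x ^+ 2.
Proof.
rewrite ger0_norm ?flat_ge0// /flat; case: ltP => [x0|_]; last first.
  by rewrite mulr_ge0 ?sqr_ge0.
have ix0 : 0 < x^-1 by rewrite invr_gt0.
rewrite expRN -invfM.
have := @expR_ge1Dxn R x^-1 m.+1 (ltW ix0).
set F := _`!%:R => h.
have F0 : 0 < F by rewrite ltr0n fact_gt0.
have {}h : x ^- m.+2 / F <= expR x^-1.
  by apply: le_trans h; rewrite exprVn lerDr.
rewrite invfM -exprVn ler_pdivrMr ?expR_gt0//.
have -> : x^-1 ^+ m = (F * x ^+ 2) * (x ^- m.+2 / F).
  have xn0 : x != 0 by rewrite gt_eqF.
  rewrite exprVn (_ : m.+2 = (2 + m)%N) // exprD invfM.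
  by field; rewrite ?xn0 ?gt_eqF ?exprn_gt0.
by rewrite ler_wpM2l// mulr_ge0 ?sqr_ge0// ltW.
Qed.

Lemma is_derive_flat m (x : R) :
  is_derive x 1 (flat m) (flat m.+2 x - m%:R * flat m.+1 x).
Proof.
have [x0|x0|->] := ltgtP x 0.
- rewrite !flat_le0 ?ltW// mulr0 subr0.
  apply: (@near_eq_is_derive _ _ _ (cst 0)).
  by near=> y; rewrite /cst flat_le0// ltW//; near: y; exact: lt_nbhsl.
- have xn0 : x != 0 by rewrite gt_eqF.
  have dV : is_derive x 1 (fun y : R => y^-1) (- x ^- 2).
    apply: DeriveDef; first exact: derivableV.
    by rewrite deriveV// derive_id -[_ *: 1]/(_ * 1) mulr1.
  have dNV : is_derive x 1 (fun y : R => - y^-1) (x ^- 2).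
    by apply: is_derive_eq (is_deriveN dV) _; rewrite opprK.
  have dE : is_derive x 1 (fun y : R => expR (- y^-1)) (x ^- 2 * expR (- x^-1)).
    have := @is_derive1_comp _ expR (fun y : R => - y^-1) x _ _
      (is_derive_expR (- x^-1)) dNV.
    by rewrite mulrC.
  have dX : is_derive x 1 (fun y : R => y ^- m) (- (m%:R * x ^- m.+1)).
    rewrite (_ : (fun y => _) = (fun y : R => y^-1) ^+ m); last first.
      by apply/funext => y; rewrite exprfctE exprVn.
    have := is_deriveX m dV.
    move=> h; apply: (is_derive_eq h).
    rewrite -[_ *: _]/(_ * _).
    case: m {h} => [|m]; first by rewrite !mul0r oppr0.
    rewrite mulrN -mulrA -exprVn -exprD -exprVn; congr (- (_ * _ ^+ _)).
    by rewrite /= addn2.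
  apply: (near_eq_is_derive (f := (fun y => y ^- m) * (fun y => expR (- y^-1)))).
    near=> y; rewrite /flat.
    suff -> : 0 < y by [].
    by near: y; exact: lt_nbhsr.
  apply: is_derive_eq (is_deriveM dX dE) _.
  rewrite /flat x0 -![_ *: _]/(_ * _) !exprS !invfM expr0 invr1.
  by ring.
rewrite !flat_le0// mulr0 subr0.
have N0 : (fun h : R => m.+2`!%:R * `|h|) @ 0^' --> (0 : R).
  rewrite -[X in _ --> X](mulr0 m.+2`!%:R); apply: cvgMl_tmp.
  rewrite -[X in _ --> X](@normr0 _ R); apply: cvg_norm.
  exact: nbhs_dnbhs.
have h : (fun h : R => h^-1 *: (flat m (h *: 1 + 0) - flat m 0)) @ 0^' --> (0 : R).
  apply: (@squeeze_cvgr _ _ _ _ (fun h => - (m.+2`!%:R * `|h|))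
    (fun h => m.+2`!%:R * `|h|)) => //; last first.
    by rewrite -[X in _ --> X]oppr0; exact: cvgN.
  near=> h; rewrite (flat_le0 m (lexx 0)) subr0 addr0 -[h *: 1]/(h * 1) mulr1.
  rewrite -ler_norml -[_ *: _]/(_ * _) normrM.
  have h0 : h != 0 by near: h; exact: nbhs_dnbhs_neq.
  rewrite normfV ler_pdivrMl ?normr_gt0//.
  apply: le_trans (flat_bound _ _) _.
  by rewrite [leRHS]mulrCA -expr2 real_normK ?num_real.
by apply: DeriveDef; [apply/cvg_ex; exists 0|exact: cvg_lim h].
Unshelve. all: by end_near. Qed.

Lemma smooth_flat m : smooth (flat m).
Proof.
move=> k; elim: k m => [|k IH] m.
  exact: is_derive_continuous (is_derive_flat m).
apply: Ck_S1 (is_derive_flat m) _.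
apply: CkD; first exact: IH.
rewrite [X in Ck _ X](_ : _ = fun x => - m%:R * flat m.+1 x).
  by apply: CkM => //; exact: Ck_cst.
by apply/funext => x; rewrite mulNr.
Qed.

End flat.

Section smooth_step.
Context (R : realType).

(** The denominator never vanishes since [x] and [1 - x] are not both
    nonpositive, so the quotient below is a smooth step from 0 to 1. *)
Definition step_den (x : R) : R := flat 0 x + flat 0 (1 - x).

Definition step (x : R) : R := flat 0 x / step_den x.

Lemma step_den_gt0 x : 0 < step_den x.
Proof.
rewrite /step_den; have [x0|x0] := ltP 0 x.
  by rewrite ltr_pwDl ?flat_gt0 ?flat_ge0.
by rewrite ltr_wpDl ?flat_gt0 ?flat_ge0// subr_gt0 (le_lt_trans x0).
Qed.

Lemma step_le0 x : x <= 0 -> step x = 0.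
Proof. by move=> x0; rewrite /step flat_le0// mul0r. Qed.

Lemma step_ge1 x : 1 <= x -> step x = 1.
Proof.
move=> x1; have := step_den_gt0 x.
rewrite /step /step_den [flat 0 (1 - x)]flat_le0 ?subr_le0// addr0 => h.
by rewrite divff// gt_eqF.
Qed.

Lemma is_derive_step (x : R) : is_derive x 1 step
  ((flat 2 x * flat 0 (1 - x) + flat 0 x * flat 2 (1 - x)) / step_den x ^+ 2).
Proof.
have dA : is_derive x 1 (flat 0) (flat 2 x).
  by apply: is_derive_eq (is_derive_flat 0 x) _; rewrite mul0r subr0.
have d1 : is_derive x 1 (fun y : R => 1 - y) (-1).
  by apply: is_derive_eq (is_deriveB (is_derive_cst (1 : R) x 1)
    (is_derive_id x 1)) _; rewrite sub0r.
have dB : is_derive x 1 (fun y => flat 0 (1 - y)) (- flat 2 (1 - x)).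
  have := @is_derive1_comp _ (flat 0) (fun y : R => 1 - y) x _ _
    (is_derive_flat 0 (1 - x)) d1.
  by rewrite mul0r subr0 mulrN1.
have dD : is_derive x 1 step_den (flat 2 x - flat 2 (1 - x)).
  exact: is_deriveD.
have dn0 y : step_den y != 0 by rewrite gt_eqF ?step_den_gt0.
have dI : is_derive x 1 (fun y => (step_den y)^-1)
    (- (step_den x) ^- 2 * (flat 2 x - flat 2 (1 - x))).
  have [d e] := dD; apply: DeriveDef; first exact: derivableV.
  by rewrite deriveV// e.
apply: is_derive_eq (is_deriveM dA dI) _.
rewrite -![_ *: _]/(_ * _) !expr2; have := dn0 x.
by rewrite /step_den => h; field.
Qed.

Lemma derive_step_ge0 (x : R) : 0 <= 'D_1 step x.
Proof.
have [_ ->] := is_derive_step x.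
by rewrite divr_ge0 ?sqr_ge0// addr_ge0// mulr_ge0 ?flat_ge0.
Qed.

Lemma derive_step_eq0 (x : R) : (x < 0) || (1 < x) -> 'D_1 step x = 0.
Proof.
have [_ ->] := is_derive_step x; move=> /orP[x0|x1].
  by rewrite ![flat _ x]flat_le0 ?(ltW x0)// !mul0r addr0 mul0r.
by rewrite ![flat _ (1 - x)]flat_le0 ?subr_le0 ?(ltW x1)// !mulr0 addr0 mul0r.
Qed.

Lemma derive_step_gt0 (x : R) : 0 < x < 1 -> 0 < 'D_1 step x.
Proof.
move=> /andP[x0 x1]; have [_ ->] := is_derive_step x.
have y0 : 0 < 1 - x by rewrite subr_gt0.
by rewrite divr_gt0 ?exprn_gt0 ?step_den_gt0// addr_gt0// mulr_gt0 ?flat_gt0.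
Qed.

Lemma step_homo : {homo step : x y / x <= y}.
Proof.
move=> x y xy.
have dS z : derivable step z 1 by have [] := is_derive_step z.
apply: (@ger0_derive1_ndecr _ step x y) => //.
- by move=> z _; rewrite derive1E derive_step_ge0.
- exact/continuous_subspaceT/(is_derive_continuous is_derive_step).
Qed.

Lemma smooth_step : smooth step.
Proof.
move=> k; apply: CkM; first exact: smooth_flat.
apply: CkV; first by move=> x; rewrite gt_eqF ?step_den_gt0.
apply: CkD; first exact: smooth_flat.
apply: (@Ck_comp_affine _ _ (fun x : R => 1 - x) (fun v => - v)).
- by move=> s x v /=; rewrite -[_ *: _]/(_ * _); ring.
- by move=> x; apply: continuousB; [exact: cvg_cst|exact: cvg_id].
- exact: smooth_flat.
Qed.

Definition bump (x : R) : R := flat 0 (1 + x) * flat 0 (1 - x).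

Lemma bump_ge0 x : 0 <= bump x.
Proof. by rewrite mulr_ge0 ?flat_ge0. Qed.

Lemma bump_le1 x : bump x <= 1.
Proof. by rewrite mulr_ile1 ?flat_ge0 ?flat0_le1. Qed.

Lemma bump_gt0 x : `|x| < 1 -> 0 < bump x.
Proof. by rewrite ltr_norml => /andP[x0 x1]; rewrite mulr_gt0// flat_gt0//; lra. Qed.

Lemma bump_eq0 x : 1 <= `|x| -> bump x = 0.
Proof.
rewrite ler_normr /bump => /orP[x1|x1].
  by rewrite [flat _ (1 - x)]flat_le0 ?mulr0//; lra.
by rewrite [flat _ (1 + x)]flat_le0 ?mul0r//; lra.
Qed.

Lemma smooth_bump : smooth bump.
Proof.
move=> k; apply: CkM.
- apply: (@Ck_comp_affine _ _ (fun x : R => 1 + x) (fun v => v)).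
  + by move=> s x v /=; rewrite -[_ *: _]/(_ * _); ring.
  + by move=> x; apply: continuousD; [exact: cvg_cst|exact: cvg_id].
  + exact: smooth_flat.
- apply: (@Ck_comp_affine _ _ (fun x : R => 1 - x) (fun v => - v)).
  + by move=> s x v /=; rewrite -[_ *: _]/(_ * _); ring.
  + by move=> x; apply: continuousB; [exact: cvg_cst|exact: cvg_id].
  + exact: smooth_flat.
Qed.

End smooth_step.

(** * Translation invariance of Lebesgue measure *)

Section translation_invariance.
Context (R : realType).

Lemma product_measure_preserving d1 d2 (T1 : measurableType d1)
    (T2 : measurableType d2)
    (m1 : {sigma_finite_measure set T1 -> \bar R})
    (m2 : {sigma_finite_measure set T2 -> \bar R}) (f1 : T1 -> T1) (f2 : T2 -> T2) :
  measurable_fun setT f1 -> measurable_fun setT f2 ->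
  (forall A, measurable A -> m1 (f1 @^-1` A) = m1 A) ->
  (forall A, measurable A -> m2 (f2 @^-1` A) = m2 A) ->
  forall A, measurable A ->
    (m1 \x m2)%E ((fun p => (f1 p.1, f2 p.2)) @^-1` A) = (m1 \x m2)%E A.
Proof.
move=> mf1 mf2 f1P f2P A mA.
have mf : measurable_fun setT (fun p : T1 * T2 => (f1 p.1, f2 p.2)).
  by apply: measurable_fun_pair; apply: measurableT_comp.
apply/esym; rewrite (@product_measure_unique _ _ _ _ _ m1 m2
  (measure_function_pushforward__canonical__measure_function_Measure
    (m1 \x m2)%E mf))//.
move=> B C mB mC; rewrite /= /pushforward.
rewrite (_ : _ @^-1` _ = (f1 @^-1` B) `*` (f2 @^-1` C)); last first.
  by apply/seteqP; split => p.
have mB' : measurable (f1 @^-1` B).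
  by rewrite -[X in measurable X]setTI; exact: mf1.
have mC' : measurable (f2 @^-1` C).
  by rewrite -[X in measurable X]setTI; exact: mf2.
by rewrite product_measure1E//; congr (_ * _)%E; [exact: f1P|exact: f2P].
Qed.

Lemma lebesgue_measure_shift (a : R) (A : set (measurableTypeR R)) :
  measurable A -> lebesgue_measure ((fun x => a + x) @^-1` A) = lebesgue_measure A.
Proof.
move=> mA.
have mf : measurable_fun setT (fun x : measurableTypeR R => a + x : measurableTypeR R).
  by apply: measurable_funD => //; exact: measurable_cst.
apply/esym.
apply: (@lebesgue_measure_unique R
  (measure_function_pushforward__canonical__measure_function_Measure
    (@lebesgue_measure R) mf)) => // X /ocitvP[->|[[b c] /= bc ->]].
  by rewrite !measure0.
rewrite /pushforward (_ : _ @^-1` _ = `]b - a, c - a]%classic); last first.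
  apply/seteqP; split=> x /=; rewrite !in_itv/= ltrBlDl lerBrDl//.
rewrite !lebesgue_measure_itv/= !lte_fin ltrD2r.
by case: ifP => // _; rewrite !EFinN -!EFinD; congr EFin; ring.
Qed.

Lemma measurable_shift_rV n (a : 'rV[R]_n) :
  measurable_fun setT (fun x : 'rV[R]_n => a + x).
Proof.
apply: measurable_rV => i; under eq_fun do rewrite mxE.
apply: measurable_funD; first exact: measurable_cst.
exact: measurable_coord.
Qed.

(** A translation of R^(n+1) is the product of a translation of the first
    coordinate and one of the remaining ones. *)
Lemma lebesgue_rV_shift n (a : 'rV[R]_n) (A : set 'rV[R]_n) :
  measurable A -> lebesgue_rV R n ((fun x => a + x) @^-1` A) = lebesgue_rV R n A.
Proof.
elim: n a A => [|n IH] a A mA /=.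
  by rewrite (_ : _ @^-1` A = A)//; apply/seteqP; split=> x /=;
    rewrite (thinmx0 (a + x)) (thinmx0 x).
rewrite /lebesgueS /pushforward.
pose b : 'rV[R]_n := \row_j a ord0 (lift ord0 j).
have E : (fun x => a + x) \o @consrV R n =
    @consrV R n \o (fun p => (a ord0 ord0 + p.1, b + p.2)).
  apply/funext => p; apply/rowP => i /=; rewrite mxE.
  by have [j ->|->] := unliftP ord0 i; rewrite ?consrV0 ?consrVS// !mxE.
rewrite -[X in _ X = _]/(((fun x => a + x) \o @consrV R n) @^-1` A) E.
apply: (@product_measure_preserving _ _ _ _ (@lebesgue_measure R)
  (lebesgue_rV R n) (fun x => a ord0 ord0 + x) (fun x => b + x)).
- by apply: measurable_funD => //; exact: measurable_cst.
- exact: measurable_shift_rV.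
- exact: lebesgue_measure_shift.
- exact: IH.
- rewrite -[X in measurable X]setTI; exact: measurable_consrV.
Qed.

End translation_invariance.

(** * Measurability on space-time *)

Lemma open_measurable_rV (R : realType) n (A : set 'rV[R]_n) : open A -> measurable A.
Proof. by move=> oA; exact: sub_gen_smallest. Qed.

Section product_measurability.
Context (R : realType) (n : nat).

Local Notation rvR := ('rV[R]_n * measurableTypeR R)%type.

(** The product sigma-algebra of R^n x R contains the open sets because
    R^n x R embeds measurably into R^(n+1), whose Borel sets are generated by
    the open sets. *)
Lemma open_measurable_rVR (A : set ('rV[R]_n * R)) :
  open A -> measurable (A : set rvR).
Proof.
move=> oA.
pose g (p : rvR) : 'rV[R]_n.+1 := consrV (p.2, p.1).
pose h (x : 'rV[R]_n.+1) : 'rV[R]_n * R :=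
  (\row_j x ord0 (lift ord0 j), x ord0 ord0).
have mg : measurable_fun setT g.
  apply: (measurableT_comp (@measurable_consrV R n)).
  exact: (measurable_fun_pair measurable_snd measurable_fst).
have ch : continuous h.
  move=> x B /nbhs_ballP[e /= e0 xeB].
  apply/nbhs_ballP; exists e => //= y [_ xy]; apply: xeB.
  by split; [split=> // i j; rewrite !mxE; exact: xy|exact: xy].
have hK p : h (g p) = p.
  case: p => p t; rewrite /h /g consrV0; congr pair.
  by apply/rowP => j; rewrite mxE consrVS.
rewrite (_ : A = g @^-1` (h @^-1` A)); last first.
  by apply/seteqP; split=> p /=; rewrite hK.
have oh : open (h @^-1` A) by apply: open_comp => // x _; exact: ch.
by have := mg measurableT _ (open_measurable_rV oh); rewrite setTI.
Qed.

Lemma measurable_continuous_restrict (D : set ('rV[R]_n * R)) u :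
  open D -> {in D, continuous u} -> measurable_fun setT (u \_ D : rvR -> R).
Proof.
move=> oD cu.
apply/(measurable_restrictT _ (open_measurable_rVR oD)).
apply: (measurability _ (RGenOpens.measurableE R)) => _ [_ [a [b ->]] <-].
apply: open_measurable_rVR.
rewrite openE => p [Dp up].
have : nbhs p (u @^-1` `]a, b[).
  apply: (cu p); first exact/mem_set.
  by apply: open_nbhs_nbhs; split => //; exact: interval_open.
apply: filterS2 (open_nbhs_nbhs (conj oD Dp)) => q; by split.
Qed.

End product_measurability.

Section fubini_measurable.
Context d1 d2 (T1 : measurableType d1) (T2 : measurableType d2) (R : realType).
Variable m : {sigma_finite_measure set T2 -> \bar R}.

Lemma measurable_fun_section_integral (f : T1 * T2 -> R) :
  measurable_fun setT f ->
  measurable_fun setT (fun x => \int[m]_y f (x, y)).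
Proof.
move=> mf; have mEf : measurable_fun setT (EFin \o f) by exact/measurable_EFinP.
apply: (measurableT_comp (fine_measurable measurableT)).
rewrite (_ : (fun x => _) =
    (fun x => fubini_F m (EFin \o f)^\+%E x - fubini_F m (EFin \o f)^\-%E x)%E).
  apply: emeasurable_funB; apply: measurable_fun_fubini_tonelli_F => //.
    exact: measurable_funepos.
  exact: measurable_funeneg.
apply/funext => x; rewrite /fubini_F integralE.
by congr (_ - _)%E; apply: eq_integral => y _; rewrite !(funeposE, funenegE).
Qed.

End fubini_measurable.

(** * Test functions on space-time *)

Section test_functions.
Context (R : realType) (n : nat).
Implicit Types (x y : 'rV[R]_n) (r : R).

Definition box_bump (x : 'rV[R]_n) (r : R) (y : 'rV[R]_n) : R :=
  \prod_i bump ((y ord0 i - x ord0 i) / r).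

Definition box (x : 'rV[R]_n) (r : R) : set 'rV[R]_n :=
  [set y | forall i, `[x ord0 i - r, x ord0 i + r]%classic (y ord0 i)].

Lemma boxE x r y : box x r y <-> forall i, `|y ord0 i - x ord0 i| <= r.
Proof.
by split=> h i; have := h i; rewrite /= in_itv/= ler_norml => /andP[h1 h2];
  apply/andP; split; lra.
Qed.

Lemma box_bump_ge0 x r y : 0 <= box_bump x r y.
Proof. by apply: prodr_ge0 => i _; exact: bump_ge0. Qed.

Lemma box_bump_le1 x r y : box_bump x r y <= 1.
Proof. by apply: prodr_ile1 => i _; rewrite bump_ge0 bump_le1. Qed.

Lemma box_bump_gt0 x r y : 0 < r -> (forall i, `|y ord0 i - x ord0 i| < r) ->
  0 < box_bump x r y.
Proof.
move=> r0 xy; apply: prodr_gt0 => i _; apply: bump_gt0.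
by rewrite normrM normfV (gtr0_norm r0) ltr_pdivrMr// mul1r.
Qed.

Lemma box_bump_eq0 x r y : 0 < r -> ~ box x r y -> box_bump x r y = 0.
Proof.
move=> r0; rewrite boxE => /existsNP[i /negP]; rewrite -ltNge => ri.
rewrite /box_bump (bigD1 i)//= bump_eq0 ?mul0r//.
by rewrite normrM normfV (gtr0_norm r0) ler_pdivlMr// mul1r ltW.
Qed.

Lemma box_bump_shift x r y : box_bump x r (x + y) = box_bump 0 r y.
Proof. by apply: eq_bigr => i _; rewrite !mxE addrAC subrr add0r subr0. Qed.

Lemma smooth_box_bump x r :
  smooth (fun p : 'rV[R]_n * R => box_bump x r p.1).
Proof.
move=> k; apply: Ck_prod => i.
apply: (@Ck_comp_affine _ _ (fun p : 'rV[R]_n * R => (p.1 ord0 i - x ord0 i) / r)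
  (fun v => v.1 ord0 i / r) _ k (@bump R)).
- by move=> s p v /=; rewrite !mxE; ring.
- move=> p; apply: cvgM; last exact: cvg_cst.
  apply: cvgB; last exact: cvg_cst.
  apply: (@continuous_comp _ _ _ fst (fun y : 'rV[R]_n => y ord0 i)).
    exact: cvg_fst.
  exact: coord_continuous.
- exact: smooth_bump.
Qed.

Lemma smooth_snd (psi : R -> R) :
  smooth psi -> smooth (fun p : 'rV[R]_n * R => psi p.2).
Proof.
move=> h k; apply: (@Ck_comp_affine _ _ (fun p : 'rV[R]_n * R => p.2) snd) => //.
by move=> p; exact: cvg_snd.
Qed.

Lemma compact_box x r : compact (box x r).
Proof.
exact: (@rV_compact _ _ (fun i => `[x ord0 i - r, x ord0 i + r]%classic)
  (fun i => @segment_compact R _ _)).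
Qed.

Definition bump_tensor x r (psi : R -> R) (p : 'rV[R]_n * R) : R :=
  box_bump x r p.1 * psi p.2.

Lemma test_function_bump_tensor D x r (s1 s2 : R) (psi : R -> R) :
  0 < r -> smooth psi -> (forall t, ~ `[s1, s2]%classic t -> psi t = 0) ->
  box x r `*` `[s1, s2] `<=` D -> test_function D (bump_tensor x r psi).
Proof.
move=> r0 spsi psi0 BD.
have cB : compact (box x r `*` `[s1, s2]).
  by apply: compact_setX; [exact: compact_box|exact: segment_compact].
have clB : closed (box x r `*` `[s1, s2]).
  by apply: compact_closed cB; exact: norm_hausdorff.
have sB : closure [set p | bump_tensor x r psi p != 0] `<=` box x r `*` `[s1, s2].
  apply: (subset_trans _ clB); apply: closure_subset => p /eqP fp.
  split; apply: contrapT => h; apply: fp.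
    by rewrite /bump_tensor box_bump_eq0// mul0r.
  by rewrite /bump_tensor psi0// mulr0.
split; last exact: subset_trans BD.
  by move=> k; apply: CkM; [exact: smooth_box_bump|exact: smooth_snd].
exact: (subclosed_compact (@closed_closure _ _) cB sB).
Qed.

Lemma derive_bump_tensor x r (psi : R -> R) p : derivable psi p.2 1 ->
  'D_(0, 1) (bump_tensor x r psi) p = bump_tensor x r ('D_1 psi) p.
Proof.
move=> dpsi.
transitivity ('D_(0, 1) (box_bump x r p.1 \*: (psi \o (snd : 'rV[R]_n * R -> R))) p).
  by rewrite /derive /bump_tensor /=; under eq_fun do rewrite scaler0 add0r.
have sndE (s : R) (q v : 'rV[R]_n * R) : (s *: v + q).2 = s * v.2 + q.2 by [].
rewrite deriveZ; last first.
  exact: (@derivable_comp_affine _ _ snd snd sndE psi (0, 1) p).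
by rewrite (derive_comp_affine sndE).
Qed.

End test_functions.

Lemma nbhs_box (R : realType) n (x : 'rV[R]_n) (A : set 'rV[R]_n) :
  nbhs x A -> exists2 e, 0 < e & forall r, r < e -> box x r `<=` A.
Proof.
move=> /nbhs_ballP[e /= e0 eA]; exists e => // r re y /boxE xy.
apply: eA; split=> // i j; rewrite ord1 -ball_normE /= distrC.
exact: le_lt_trans (xy j) re.
Qed.

Lemma nbhs_box_pair (R : realType) n (x : 'rV[R]_n) (t : R)
    (A : set ('rV[R]_n * R)) : nbhs (x, t) A ->
  exists2 e, 0 < e & forall r, r < e -> forall y s, box x r y -> `|s - t| <= r ->
    A (y, s).
Proof.
move=> /nbhs_ballP[e /= e0 eA]; exists e => // r re y s /boxE xy st.
apply: eA; split => /=.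
  split=> // i j; rewrite ord1 -ball_normE /= distrC.
  exact: le_lt_trans (xy j) re.
by rewrite -ball_normE /= distrC; exact: le_lt_trans st re.
Qed.

Lemma derive_supported (R : realType) (psi : R -> R) (s1 s2 : R) :
  (forall t, ~ `[s1, s2]%classic t -> psi t = 0) ->
  forall t, ~ `[s1, s2]%classic t -> 'D_1 psi t = 0.
Proof.
move=> psi0 t nt; rewrite -(derive_cst (0 : R) t (1 : R)).
apply: near_eq_derive.
have oC : open (~` `[s1, s2]%classic) by apply: closed_openC; exact: itv_closed.
by apply: filterS (open_nbhs_nbhs (conj oC nt)) => s /psi0.
Qed.

(** * Integration against functions supported in a box *)

Lemma integrable_lincomb d (T : measurableType d) (R : realType)
    (m : {measure set T -> \bar R}) (F G : T -> R) (a b : R) :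
  m.-integrable setT (EFin \o F) -> m.-integrable setT (EFin \o G) ->
  m.-integrable setT (EFin \o (fun t => a * F t + b * G t)).
Proof.
move=> iF iG.
by apply: eq_integrable (integrableD measurableT
  (integrableZl measurableT a iF) (integrableZl measurableT b iG)).
Qed.

Lemma Rintegral_lincomb d (T : measurableType d) (R : realType)
    (m : {measure set T -> \bar R}) (F G : T -> R) (a b : R) :
  m.-integrable setT (EFin \o F) -> m.-integrable setT (EFin \o G) ->
  \int[m]_t (a * F t + b * G t) = a * (\int[m]_t F t) + b * (\int[m]_t G t).
Proof.
move=> iF iG; rewrite RintegralD ?RintegralZl//.
  by apply: eq_integrable (integrableZl measurableT a iF).
by apply: eq_integrable (integrableZl measurableT b iG).
Qed.

Lemma Rintegral_gt0 d (T : measurableType d) (R : realType)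
    (m : {measure set T -> \bar R}) (F : T -> R) (B : set T) :
  m.-integrable setT (EFin \o F) -> (forall t, 0 <= F t) ->
  measurable B -> (0 < m B)%E -> (forall t, B t -> 0 < F t) ->
  0 < \int[m]_t F t.
Proof.
move=> iF F0 mB B0 BF; rewrite lt_neqAle Rintegral_ge0// andbT; apply/eqP => e.
have mF : measurable_fun setT (EFin \o F) by exact: measurable_int iF.
have I0 : (\int[m]_t `|(EFin \o F) t| = 0)%E.
  rewrite -[RHS]/(0%:E) e /Rintegral fineK; last exact: integrable_fin_num.
  by apply: eq_integral => t _ /=; rewrite ger0_norm.
have [N [mN N0 FN]] := (ae_eq_integral_abs m measurableT mF).1 I0.
have : (m B <= m N)%E.
  apply: le_measure; rewrite ?inE// => t Bt; apply: FN => /= /(_ Logic.I) [] Ft.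
  by have := BF t Bt; rewrite Ft ltxx.
by rewrite N0 leNgt B0.
Qed.

Section box_integration.
Context (R : realType) (n : nat).

Local Notation rvR := ('rV[R]_n * measurableTypeR R)%type.
Local Notation leb := (lebesgue_rV R n).
Local Notation leb1 := (@lebesgue_measure R).
Local Notation vol := (leb \x leb1)%E.

(** Every integrand below is a product of such functions with a test function,
    and is integrable because the latter lives in a set of finite measure. *)
Definition bounded_measurable (F : rvR -> R) : Prop :=
  measurable_fun setT F /\ exists C, forall p, `|F p| <= C.

Lemma bounded_measurable_cst (c : R) : bounded_measurable (fun=> c).
Proof. by split; [exact: measurable_cst|exists `|c|]. Qed.

Lemma bounded_measurableD F G : bounded_measurable F -> bounded_measurable G ->
  bounded_measurable (fun p => F p + G p).
Proof.
move=> [mF [C FC]] [mG [D GD]]; split; first exact: measurable_funD.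
by exists (C + D) => p; rewrite (le_trans (ler_normD _ _))// lerD.
Qed.

Lemma bounded_measurableM F G : bounded_measurable F -> bounded_measurable G ->
  bounded_measurable (fun p => F p * G p).
Proof.
move=> [mF [C FC]] [mG [D GD]]; split; first exact: measurable_funM.
by exists (C * D) => p; rewrite normrM ler_pM.
Qed.

Lemma bounded_measurableB F G : bounded_measurable F -> bounded_measurable G ->
  bounded_measurable (fun p => F p - G p).
Proof.
move=> bF bG; rewrite (_ : (fun p => _) = fun p => F p + (-1) * G p).
  by apply: bounded_measurableD => //; apply: bounded_measurableM => //;
    exact: bounded_measurable_cst.
by apply/funext => p; rewrite mulN1r.
Qed.

Lemma measurable_continuous_rVR (F : 'rV[R]_n * R -> R) :
  continuous F -> measurable_fun setT (F : rvR -> R).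
Proof.
move=> cF; rewrite -(patch_setT (fun=> point) F).
apply: (measurable_continuous_restrict openT) => p _; exact: cF.
Qed.

Lemma bounded_measurable_time (g : R -> R) s1 s2 : continuous g ->
  (forall t, ~ `[s1, s2]%classic t -> g t = 0) ->
  bounded_measurable (fun p => g p.2).
Proof.
move=> cg g0; split.
  apply: measurable_continuous_rVR => p.
  by apply: (@continuous_comp _ _ _ snd g); [exact: cvg_snd|exact: cg].
have [s12|s21] := leP s1 s2; last first.
  exists 0 => p; rewrite g0 ?normr0//= in_itv/= => /andP[h1 h2].
  by have := le_trans h1 h2; rewrite leNgt s21.
have [c _ cmax] : exists2 c, c \in `[s1, s2] &
    forall t, t \in `[s1, s2] -> `|g t| <= `|g c|.
  apply: (@EVT_max _ (fun t => `|g t|)) => //.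
  apply: continuous_subspaceT => t.
  by apply: cvg_norm; exact: cg.
exists `|g c| => p.
have [h|h] := pselect (`[s1, s2]%classic p.2); first exact: cmax.
by rewrite g0// normr0.
Qed.

Lemma bounded_measurable_box_bump (r : R) :
  bounded_measurable (fun p => box_bump 0 r p.1).
Proof.
split; first exact: measurable_continuous_rVR (smooth_box_bump 0 r 0).
by exists 1 => p; rewrite ger0_norm ?box_bump_ge0 ?box_bump_le1.
Qed.

Lemma measurable_centered_box (x : 'rV[R]_n) r : measurable (box x r).
Proof.
exact: (@measurable_box R n (fun i => `[x ord0 i - r, x ord0 i + r]%classic)
  (fun i => measurable_itv _)).
Qed.

Lemma lebesgue_rV_box_lty (x : 'rV[R]_n) (r : R) : (leb (box x r) < +oo)%E.
Proof.
rewrite (@lebesgue_rV_box R n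
  (fun i => `[x ord0 i - r, x ord0 i + r]%classic))//.
rewrite ltey_eq prode_fin_num// => i _.
by rewrite lebesgue_measure_itv/=; case: ifP.
Qed.

Lemma integrable_box_supported (F : rvR -> R) (r s1 s2 : R) :
  bounded_measurable F ->
  (forall p, ~ (box 0 r `*` `[s1, s2]%classic) p -> F p = 0) ->
  vol.-integrable setT (EFin \o F).
Proof.
move=> [mF [C FC]] F0; set B := _ `*` _ in F0.
have mB : measurable (B : set rvR) by apply: measurableX => //; exact: measurable_centered_box.
rewrite (_ : EFin \o F = (EFin \o F) \_ B); last first.
  apply/funext => p; rewrite patchE; case: ifPn => // /negP pB.
  by rewrite /= F0// => Bp; apply: pB; exact/mem_set.
apply/(integrable_mkcond _ mB).
apply: measurable_bounded_integrable => //.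
- rewrite [X in (X < _)%E]product_measure1E//; last exact: measurable_centered_box.
  apply: lte_mul_pinfty => //; last first.
    by rewrite [X in (X < _)%E]lebesgue_measure_itv/=; case: ifP => _; rewrite ?ltry.
  by rewrite ge0_fin_numE//; exact: lebesgue_rV_box_lty.
- exact: measurable_funTS.
- exists C; split; first exact: num_real.
  by move=> y Cy p _; rewrite /= (le_trans (FC p))// ltW.
Qed.

Lemma Rintegral_shift (F : rvR -> R) (x : 'rV[R]_n) :
  measurable_fun setT F ->
  vol.-integrable setT (EFin \o (fun p => F (x + p.1, p.2))) ->
  \int[vol]_p F p = \int[vol]_p F (x + p.1, p.2).
Proof.
move=> mF iF; congr fine.
have mphi : measurable_fun setT (fun p : rvR => (x + p.1, p.2) : rvR).
  apply: measurable_fun_pair => //.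
  exact: measurableT_comp (@measurable_shift_rV R n x) measurable_fst.
rewrite -(@eq_measure_integral _ _ _ setT vol (pushforward vol (fun p : rvR => (x + p.1, p.2)))).
  rewrite (@integral_pushforward _ _ _ _ _ _ mphi vol setT (EFin \o F))//.
  exact/measurable_EFinP.
move=> A mA _.
apply: (@product_measure_preserving _ _ _ _ _ leb leb1 (fun y => x + y) idfun) => //.
- exact: measurable_shift_rV.
- exact: measurable_id.
- exact: lebesgue_rV_shift.
Qed.

Lemma integral_derivative_supported (g dg : R -> R) s1 s2 :
  (forall t : R, is_derive t 1 g (dg t)) -> continuous dg ->
  (forall t, ~ `[s1, s2]%classic t -> g t = 0) ->
  (forall t, ~ `[s1, s2]%classic t -> dg t = 0) ->
  (\int[leb1]_t (dg t)%:E = 0)%E.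
Proof.
move=> gD cdg g0 dg0.
(* g vanishes at a and b, and it does so even if s1 > s2 *)
pose a := Num.min s1 s2 - 1; pose b := Num.max s1 s2 + 1.
have ab : a < b.
  rewrite /a /b; have : Num.min s1 s2 <= Num.max s1 s2 by rewrite ge_min le_max lexx.
  lra.
have sab t : `[s1, s2]%classic t -> `]a, b[%classic t.
  rewrite /= !in_itv/= => /andP[h1 h2]; rewrite /a /b.
  have : Num.min s1 s2 <= s1 by rewrite ge_min lexx.
  have : s2 <= Num.max s1 s2 by rewrite le_max lexx orbT.
  by move=> h3 h4; apply/andP; split; lra.
have cg := is_derive_continuous gD.
transitivity (\int[leb1]_(t in `[a, b]) (dg t)%:E)%E.
  rewrite [RHS]integral_mkcond; apply: eq_integral => t _.
  rewrite patchE; case: ifPn => // /negP nt; rewrite dg0// => /sab.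
  by rewrite /= in_itv/= => /andP[h1 h2]; apply: nt; rewrite inE/= in_itv/= !ltW.
rewrite (@continuous_FTC2 R dg g a b ab).
- rewrite !g0 ?subee//.
  + by move=> /sab; rewrite /= in_itv/= ltxx.
  + by move=> /sab; rewrite /= in_itv/= ltxx andbF.
- exact: continuous_subspaceT.
- split; first by move=> t _; have [] := gD t.
  + by apply: cvg_at_right_filter; exact: cg.
  + by apply: cvg_at_left_filter; exact: cg.
- by move=> t _; rewrite derive1E; have [] := gD t.
Qed.

(** Integration by parts in time, without boundary terms. *)
Lemma Rintegral_bump_derivative (r : R) (g dg : R -> R) s1 s2 : 0 < r ->
  (forall t : R, is_derive t 1 g (dg t)) -> continuous dg ->
  (forall t, ~ `[s1, s2]%classic t -> g t = 0) ->
  (forall t, ~ `[s1, s2]%classic t -> dg t = 0) ->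
  \int[vol]_p (box_bump 0 r p.1 * dg p.2) = 0.
Proof.
move=> r0 gD cdg g0 dg0.
have ix : vol.-integrable setT (EFin \o (fun p : rvR => box_bump 0 r p.1 * dg p.2)).
  apply: (@integrable_box_supported _ r s1 s2).
    apply: bounded_measurableM; first exact: bounded_measurable_box_bump.
    exact: bounded_measurable_time dg0.
  move=> p /not_andP[h|h]; first by rewrite box_bump_eq0// mul0r.
  by rewrite dg0// mulr0.
rewrite /Rintegral -(integral12_prod_meas1 ix) /fubini_F/= integral0_eq// => x _.
under eq_integral do rewrite EFinM.
rewrite integralZl//; last first.
  have mI : measurable (`[s1, s2]%classic : set (measurableTypeR R)).
    exact: measurable_itv.
  have h : leb1.-integrable `[s1, s2] (EFin \o dg).
    apply: continuous_compact_integrable; first exact: segment_compact.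
    exact: continuous_subspaceT.
  have {}h := (@integrable_mkcond _ (measurableTypeR R) R leb1 _ (EFin \o dg) mI).1 h.
  apply: eq_integrable h => //= t _.
  rewrite patchE; case: ifPn => // /negP nt.
  by rewrite dg0// => ht; apply: nt; exact/mem_set.
by rewrite (integral_derivative_supported gD cdg g0 dg0) mule0.
Qed.

Lemma integrable_against_bump (F : rvR -> R) (g : R -> R) (r s1 s2 : R) :
  0 < r -> bounded_measurable F -> continuous g ->
  (forall t, ~ `[s1, s2]%classic t -> g t = 0) ->
  vol.-integrable setT (EFin \o (fun p => F p * (box_bump 0 r p.1 * g p.2))).
Proof.
move=> r0 bF cg g0; apply: (@integrable_box_supported _ r s1 s2).
  apply: bounded_measurableM => //; apply: bounded_measurableM.
    exact: bounded_measurable_box_bump.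
  exact: bounded_measurable_time g0.
move=> p /not_andP[h|h]; first by rewrite box_bump_eq0// mul0r mulr0.
by rewrite g0// !mulr0.
Qed.

End box_integration.

(** * Plateau functions in time *)

Section ramp.
Context (R : realType).
Variables (t1 t2 h : R).
Hypothesis h0 : 0 < h.
Hypothesis t12 : t1 < t2.

Definition delayed_step (t0 s : R) : R := step ((s - t0) / h).

Definition step_pulse (t0 s : R) : R := 'D_1 (@step R) ((s - t0) / h) / h.

Lemma smooth_delayed_step t0 : smooth (delayed_step t0).
Proof.
move=> k; apply: (@Ck_comp_affine _ _ (fun s : R => (s - t0) / h) (fun v => v / h)).
- by move=> s x v /=; rewrite -[_ *: _]/(_ * _); ring.
- move=> x; apply: cvgM; last exact: cvg_cst.
  by apply: cvgB; [exact: cvg_id|exact: cvg_cst].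
- exact: smooth_step.
Qed.

Lemma is_derive_delayed_step t0 (s : R) :
  is_derive s 1 (delayed_step t0) (step_pulse t0 s).
Proof.
have e (c x v : R) : (c *: v + x - t0) / h = c * (v / h) + (x - t0) / h.
  by rewrite -[_ *: _]/(_ * _); ring.
have [dstep _] := is_derive_step ((s - t0) / h).
have [d1 d2] := derivableV1 (1 / h) dstep.
apply: DeriveDef; first exact: (derivable_comp_affine e).
by rewrite (derive_comp_affine e) d2 mul1r mulrC.
Qed.

Lemma continuous_step_pulse t0 : continuous (step_pulse t0).
Proof.
rewrite (_ : step_pulse t0 = 'D_1 (delayed_step t0)).
  exact: ((smooth_delayed_step t0 1).2 1).2.
by apply/funext => s; have [_ ->] := is_derive_delayed_step t0 s.
Qed.

Lemma step_pulse_ge0 t0 s : 0 <= step_pulse t0 s.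
Proof. by rewrite divr_ge0 ?derive_step_ge0// ltW. Qed.

Lemma step_pulse_eq0 t0 s : ~ `[t0, t0 + h]%classic s -> step_pulse t0 s = 0.
Proof.
rewrite /= in_itv/= => /negP; rewrite negb_and -!ltNge => hs.
rewrite /step_pulse derive_step_eq0 ?mul0r//.
by rewrite pmulr_llt0 ?invr_gt0// subr_lt0 ltr_pdivlMr// mul1r ltrBrDr addrC.
Qed.

Lemma step_pulse_gt0 t0 s : t0 < s < t0 + h -> 0 < step_pulse t0 s.
Proof.
move=> /andP[s0 s1]; rewrite divr_gt0// derive_step_gt0//.
by rewrite divr_gt0 ?subr_gt0//= ltr_pdivrMr// mul1r ltrBlDl.
Qed.

(** A smoothed indicator of [t1, t2]. Its derivative is a positive pulse after
    [t1] minus the same pulse after [t2]: testing an evolution inequality against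
    it compares the two times. *)
Definition plateau (s : R) : R := delayed_step t1 s - delayed_step t2 s.

Lemma smooth_plateau : smooth plateau.
Proof.
move=> k; rewrite (_ : plateau = fun s => delayed_step t1 s + (-1) * delayed_step t2 s).
  apply: CkD; first exact: smooth_delayed_step.
  by apply: CkM; [exact: Ck_cst|exact: smooth_delayed_step].
by apply/funext => s; rewrite mulN1r.
Qed.

Lemma plateau_ge0 s : 0 <= plateau s.
Proof.
rewrite subr_ge0; apply: step_homo.
by rewrite ler_pM2r ?invr_gt0// lerB// ltW.
Qed.

Lemma plateau_eq0 s : ~ `[t1, t2 + h]%classic s -> plateau s = 0.
Proof.
rewrite /= in_itv/= => /negP; rewrite negb_and -!ltNge /plateau /delayed_step.
move=> /orP[hs|hs].
  rewrite !step_le0 ?subrr// pmulr_lle0 ?invr_gt0// subr_le0 ltW//.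
  exact: lt_trans t12.
have ge1 t0 : t0 + h <= s -> 1 <= (s - t0) / h.
  by move=> hs'; rewrite ler_pdivlMr// mul1r lerBrDl.
by rewrite !step_ge1 ?subrr//; apply: ge1; rewrite ltW// (lt_trans _ hs)// ltrD2r.
Qed.

Lemma derive_plateau (s : R) : 'D_1 plateau s = step_pulse t1 s - step_pulse t2 s.
Proof.
have [_ <-] := is_deriveB (is_derive_delayed_step t1 s) (is_derive_delayed_step t2 s).
by [].
Qed.

End ramp.

Lemma Rintegral_bump_pulse_gt0 (R : realType) (n : nat) (r h t0 : R) :
  0 < r -> 0 < h ->
  0 < \int[(lebesgue_rV R n \x @lebesgue_measure R)%E]_p (box_bump 0 r p.1 * step_pulse h t0 p.2).
Proof.
move=> r0 h0.
have r20 : 0 < r / 2 by rewrite divr_gt0.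
have mB : measurable (`[t0 + h / 4, t0 + h / 2]%classic : set (measurableTypeR R)).
  exact: measurable_itv.
pose B : set ('rV[R]_n * measurableTypeR R) := box 0 (r / 2) `*` `[t0 + h / 4, t0 + h / 2]%classic.
apply: (@Rintegral_gt0 _ _ _ _ _ B).
- have := @integrable_against_bump R n (fun=> 1) (step_pulse h t0) r t0 (t0 + h)
    r0 (bounded_measurable_cst n (1 : R)) (@continuous_step_pulse R h t0)
    (@step_pulse_eq0 R h h0 t0).
  by under [X in EFin \o X]eq_fun do rewrite mul1r.
- by move=> p; rewrite mulr_ge0 ?box_bump_ge0 ?step_pulse_ge0.
- by apply: measurableX => //; exact: measurable_centered_box.
- have box_gt0 : (0 < lebesgue_rV R n (box 0 (r / 2)))%E.
    rewrite (@lebesgue_rV_box R n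
      (fun i => `[(0 : 'rV[R]_n) ord0 i - r / 2, (0 : 'rV[R]_n) ord0 i + r / 2]%classic))//.
    under eq_bigr => i _.
      rewrite lebesgue_measure_itv/= lte_fin mxE sub0r add0r ifT; last lra.
      over.
    rewrite prodEFin lte_fin; apply: prodr_gt0 => i _; lra.
  have itv_gt0 : (0 < @lebesgue_measure R `[(t0 + h / 4)%R, (t0 + h / 2)%R]%classic)%E.
    rewrite lebesgue_measure_itv/= lte_fin ifT; last lra.
    rewrite -EFinD lte_fin; lra.
  rewrite [X in (_ < X)%E]product_measure1E//; last exact: measurable_centered_box.
  exact: mule_gt0 box_gt0 itv_gt0.
- move=> p [/boxE hp]; rewrite /= in_itv/= => /andP[h1 h2].
  apply: mulr_gt0.
    apply: box_bump_gt0 => // i; apply: le_lt_trans (hp i) _; lra.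
  by apply: step_pulse_gt0 => //; apply/andP; split; lra.
Qed.

(** * Suprema and iterated bounds *)

(** A bound with error [C] that any error [D] improves to [q D] holds without
    error. It plays the part of Gronwall's lemma for suprema over families of
    solutions, of which only a bound uniform in time is known beforehand. *)
Lemma geometric_improvement (R : realType) (I : Type) (S : I -> Prop)
    (v m : I -> R) (q C : R) :
  0 <= q < 1 -> 0 <= C -> (forall i, S i -> v i <= m i + C) ->
  (forall D, 0 <= D -> (forall i, S i -> v i <= m i + D) ->
    forall i, S i -> v i <= m i + q * D) ->
  forall i, S i -> v i <= m i.
Proof.
move=> /andP[q0 q1] C0 vC improve i Si.
have vk k : forall j, S j -> v j <= m j + q ^+ k * C.
  elim: k => [|k IH] j Sj; first by rewrite expr0 mul1r; exact: vC.
  rewrite exprS -mulrA; apply: improve Sj => //.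
  by rewrite mulr_ge0// exprn_ge0.
rewrite -subr_le0.
have cq : (fun k => q ^+ k * C) @ \oo --> (0 : R).
  rewrite -[X in _ --> X](mul0r C); apply: cvgMr_tmp.
  by apply: cvg_expr; rewrite ger0_norm.
rewrite -(cvg_lim _ cq)//.
apply: limr_ge; first by apply/cvg_ex; exists 0.
by apply: nearW => k; rewrite lerBlDl; exact: vk.
Qed.

Lemma sup_nonneg (R : realType) (S : set R) :
  (forall s, S s -> 0 <= s) -> 0 <= sup S.
Proof.
move=> S0; have [[[s Ss] ubS]|/sup_out -> //] := pselect (has_sup S).
exact: le_trans (S0 _ Ss) (ub_le_sup ubS Ss).
Qed.

Section sup_close_facts.
Context (R : realType) (n : nat) (Omega : set 'rV[R]_n) (eta : R).
Implicit Type F : 'rV[R]_n -> 'rV[R]_n -> R.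

Definition close_pair (x y : 'rV[R]_n) : Prop :=
  [/\ Omega x, Omega y & enorm (x - y) < eta].

Lemma sup_close_ub F C : (forall x y, Omega x -> Omega y -> F x y <= C) ->
  forall x y, close_pair x y -> F x y <= sup_close Omega eta F.
Proof.
move=> FC x y xy; apply: ub_le_sup; last by exists (x, y).
by exists C => _ [[x' y'] [/= Ox Oy _] <-]; exact: FC.
Qed.

Lemma sup_close_le F C : 0 <= C -> (forall x y, close_pair x y -> F x y <= C) ->
  sup_close Omega eta F <= C.
Proof.
move=> C0 FC; rewrite /sup_close; set S := (X in sup X).
have [S0|/set0P/negP/negbNE/eqP ->] := pselect (S !=set0); last by rewrite sup0.
by apply: ge_sup => // _ [[x y] /= xy <-]; exact: FC.
Qed.

Lemma sup_close_ge0 F : (forall x y, 0 <= F x y) -> 0 <= sup_close Omega eta F.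
Proof. by move=> F0; apply: sup_nonneg => _ [[x y] _ <-]; exact: F0. Qed.

End sup_close_facts.

(** * The equation tested near a point *)

Section dirichlet.
Context (R : realType) (n : nat) (Omega : set 'rV[R]_n) (mu : 'rV[R]_n -> R)
  (u : 'rV[R]_n * R -> R).

Local Notation rvR := ('rV[R]_n * measurableTypeR R)%type.
Local Notation leb := (lebesgue_rV R n).
Local Notation vol := (leb \x @lebesgue_measure R)%E.

Hypothesis Omega_open : open Omega.
Hypothesis mu_ge0 : forall z, 0 <= mu z.
Hypothesis mu_L1 : leb.-integrable setT (fun z => (mu z)%:E).
Hypothesis mu_mass1 : \int[leb]_z mu z = 1.
Hypothesis uCb : Cb_closure Omega u.
Hypothesis uK : K0_equation Omega mu u.

Definition cylinder : set ('rV[R]_n * R) := Omega `*` `]0, +oo[.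

(** With [u] extended by zero the nonlocal term becomes an integral over the
    whole space, whose domain no longer depends on the point. *)
Definition zero_ext : rvR -> R := u \_ cylinder.

Lemma zero_extE p : cylinder p -> zero_ext p = u p.
Proof. by move=> cp; rewrite /zero_ext patchE mem_set. Qed.

Lemma zero_ext_out p : ~ cylinder p -> zero_ext p = 0.
Proof. by move=> cp; rewrite /zero_ext patchE memNset. Qed.

Lemma open_cylinder : open cylinder.
Proof.
rewrite openE => p [Op tp]; exists (Omega, `]0, +oo[%classic) => //; split.
  exact: open_nbhs_nbhs.
by apply: open_nbhs_nbhs; split => //; exact: interval_open.
Qed.

Lemma continuous_in_cylinder : {in cylinder, continuous u}.
Proof.
have [cu _] := uCb.
rewrite -continuous_open_subspace; last exact: open_cylinder.
apply: continuous_subspaceW cu => p [Op tp]; split; first exact: subset_closure.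
by move: tp; rewrite /= !in_itv/= !andbT => /ltW.
Qed.

Lemma bounded_sol : exists2 C, 0 <= C &
  forall x t, Omega x -> 0 <= t -> `|u (x, t)| <= C.
Proof.
have [_ [M [_ MP]]] := uCb; exists (`|M| + 1); first by rewrite addr_ge0.
move=> x t Ox t0; apply: MP; first by rewrite ltr_pwDr// ler_norm.
by split=> /=; [exact: subset_closure|rewrite in_itv/= t0].
Qed.

Lemma zero_ext_bound : exists2 C, 0 <= C & forall p, `|zero_ext p| <= C.
Proof.
have [C C0 CP] := bounded_sol; exists C => // p.
have [cp|cp] := pselect (cylinder p); last by rewrite zero_ext_out// normr0.
rewrite zero_extE//; case: p cp => x t [/= Ox]; rewrite in_itv/= andbT => /ltW t0.
exact: CP.
Qed.

Lemma bounded_measurable_zero_ext : bounded_measurable zero_ext.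
Proof.
split; last by have [C _ CP] := zero_ext_bound; exists C.
exact: measurable_continuous_restrict open_cylinder continuous_in_cylinder.
Qed.

Lemma measurable_mu : measurable_fun setT mu.
Proof. by apply/measurable_EFinP; exact: measurable_int mu_L1. Qed.

Lemma integrable_mu_bounded (v : 'rV[R]_n -> R) C :
  measurable_fun setT v -> (forall z, `|v z| <= C) ->
  leb.-integrable setT (EFin \o (fun z => v z * mu z)).
Proof.
move=> mv vC.
apply: (le_integrable measurableT _ _ (integrableZl measurableT C mu_L1)).
  by apply/measurable_EFinP; apply: measurable_funM => //; exact: measurable_mu.
move=> z _ /=; rewrite lee_fin normrM [X in _ <= X]normrM.
apply: ler_pM => //; apply: le_trans (vC z) _; exact: ler_norm.
Qed.

Lemma measurable_section_zero_ext (p : rvR) :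
  measurable_fun setT (fun z => zero_ext (p.1 + z, p.2)).
Proof.
apply: (measurableT_comp (bounded_measurable_zero_ext).1).
apply: measurable_fun_pair; last exact: measurable_cst.
exact: measurable_shift_rV.
Qed.

Definition mu_average (p : rvR) : R :=
  \int[leb]_z (zero_ext (p.1 + z, p.2) * mu z).

Lemma integrable_mu_average (p : rvR) :
  leb.-integrable setT (EFin \o (fun z => zero_ext (p.1 + z, p.2) * mu z)).
Proof.
have [C _ CP] := zero_ext_bound.
apply: (@integrable_mu_bounded _ C); last by move=> z; exact: CP.
exact: measurable_section_zero_ext.
Qed.

Lemma mu_average_bound (x : 'rV[R]_n) (t C : R) :
  (forall z, `|zero_ext (z, t)| <= C) -> `|mu_average (x, t)| <= C.
Proof.
move=> uC; rewrite /mu_average.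
have ii := integrable_mu_average (x, t).
apply: (le_trans (le_normr_Rintegral _ ii)) => //.
rewrite -[leRHS]mulr1 -mu_mass1 -RintegralZl//.
apply: le_Rintegral => //.
- by apply: eq_integrable (integrable_norm ii).
- by apply: eq_integrable (integrableZl measurableT C mu_L1).
- by move=> z _; rewrite normrM (ger0_norm (mu_ge0 z)) ler_wpM2r.
Qed.

Lemma bounded_measurable_mu_average : bounded_measurable mu_average.
Proof.
split.
  apply: (@measurable_fun_section_integral _ _ _ _ R leb
    (fun q : rvR * 'rV[R]_n => zero_ext (q.1.1 + q.2, q.1.2) * mu q.2)).
  apply: measurable_funM; last exact: measurableT_comp measurable_mu measurable_snd.
  apply: (measurableT_comp (bounded_measurable_zero_ext).1).
  apply: measurable_fun_pair; last exact: measurableT_comp measurable_snd measurable_fst.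
  apply: measurable_rV => i; under eq_fun do rewrite mxE.
  apply: measurable_funD.
    apply: (measurableT_comp (@measurable_coord R n i)).
    exact: measurableT_comp measurable_fst measurable_fst.
  exact: (measurableT_comp (@measurable_coord R n i) measurable_snd).
have [C C0 CP] := zero_ext_bound; exists C => -[x t]; exact: mu_average_bound.
Qed.

Lemma K0_mu_average p : cylinder p ->
  K0 Omega mu u p = mu_average p - zero_ext p.
Proof.
move=> cp; rewrite /K0 zero_extE// Rintegral_mkcond; congr (_ - _).
apply: eq_Rintegral => z _; rewrite patchE; case: ifPn => [/set_mem h|/negP h].
  by rewrite zero_extE//; split => //=; exact: cp.2.
rewrite zero_ext_out ?mul0r// => -[h1 _].
by apply: h; exact/mem_set.
Qed.

Definition K_ext (p : rvR) : R := mu_average p - zero_ext p.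

Lemma bounded_measurable_K_ext : bounded_measurable K_ext.
Proof.
apply: bounded_measurableB; first exact: bounded_measurable_mu_average.
exact: bounded_measurable_zero_ext.
Qed.

Lemma bounded_measurable_shift (F : rvR -> R) x : bounded_measurable F ->
  bounded_measurable (fun p => F (x + p.1, p.2)).
Proof.
move=> [mF [C FC]]; split; last by exists C.
apply: (measurableT_comp mF).
apply: measurable_fun_pair => //.
exact: measurableT_comp (@measurable_shift_rV R n x) measurable_fst.
Qed.

(** The equation tested near [x], moved to the origin. After this translation,
    the equations near two points can be subtracted under one integral sign. *)
Lemma weak_formulation_at (x : 'rV[R]_n) (r s1 s2 : R) (psi : R -> R) :
  0 < r -> box x r `<=` Omega -> 0 < s1 -> smooth psi ->
  (forall t, ~ `[s1, s2]%classic t -> psi t = 0) ->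
  - (\int[vol]_p (zero_ext (x + p.1, p.2) * (box_bump 0 r p.1 * 'D_1 psi p.2))) =
  \int[vol]_p (K_ext (x + p.1, p.2) * (box_bump 0 r p.1 * psi p.2)).
Proof.
move=> r0 xO s10 spsi psi0.
have dpsi t : derivable psi t 1 by exact: ((spsi 1).2 1).1.
have cdpsi : continuous ('D_1 psi) by exact: ((spsi 1).2 1).2.
have cpsi : continuous psi by exact: spsi 0.
have dpsi0 := derive_supported psi0.
have BD : box x r `*` `[s1, s2] `<=` cylinder.
  move=> p [xp]; rewrite /= in_itv/= => /andP[h _]; split; first exact: xO.
  by rewrite /= in_itv/= andbT (lt_le_trans s10).
have tphi := test_function_bump_tensor r0 spsi psi0 BD.
have shifted (F : rvR -> R) (g : R -> R) : bounded_measurable F -> continuous g ->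
    (forall t, ~ `[s1, s2]%classic t -> g t = 0) ->
    \int[vol]_p (F p * bump_tensor x r g p) =
    \int[vol]_p (F (x + p.1, p.2) * (box_bump 0 r p.1 * g p.2)).
  move=> bF cg g0; rewrite (@Rintegral_shift _ _ _ x).
  - by apply: eq_Rintegral => p _; rewrite /bump_tensor box_bump_shift.
  - apply: measurable_funM; first exact: bF.1.
    apply: measurable_continuous_rVR => p; apply: cvgM.
      exact: (smooth_box_bump x r 0).
    by apply: (@continuous_comp _ _ _ snd g); [exact: cvg_snd|exact: cg].
  - under [X in EFin \o X]eq_fun do rewrite /bump_tensor box_bump_shift.
    apply: (@integrable_box_supported _ _ _ r s1 s2).
      apply: bounded_measurableM; first exact: bounded_measurable_shift.
      apply: bounded_measurableM; first exact: bounded_measurable_box_bump.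
      exact: bounded_measurable_time g0.
    move=> p /not_andP[h|h]; first by rewrite box_bump_eq0// mul0r mulr0.
    by rewrite g0// !mulr0.
have := uK tphi.
rewrite Rintegral_mkcond [in RHS]Rintegral_mkcond.
rewrite -(shifted _ _ bounded_measurable_zero_ext cdpsi dpsi0).
rewrite -(shifted _ _ bounded_measurable_K_ext cpsi psi0).
rewrite (_ : (fun p => _) \_ _ = fun p : rvR => zero_ext p * bump_tensor x r ('D_1 psi) p); last first.
  apply/funext => p; rewrite patchE derive_bump_tensor//.
  case: ifPn => [/set_mem h|/negP h]; first by rewrite zero_extE.
  by rewrite zero_ext_out ?mul0r// => h'; apply: h; exact/mem_set.
rewrite (_ : (fun p => _) \_ _ = fun p : rvR => K_ext p * bump_tensor x r psi p)//.
apply/funext => p; rewrite patchE.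
case: ifPn => [/set_mem h|/negP h]; first by rewrite K0_mu_average.
rewrite /bump_tensor; have [h1|h1] := pselect (box x r p.1); last first.
  by rewrite box_bump_eq0// mul0r mulr0.
rewrite psi0 ?mulr0// => h2; apply: h; apply/mem_set; exact: BD.
Qed.

(** * The comparison principle *)

(** [f] is a supersolution of the evolution of the combination
    [a u(x + xi, .) + b u(y + xi, .)] for all translations [xi] that keep both
    points in the domain: testing the equation sees neighbourhoods of [x] and [y],
    never the two points alone. *)
Section two_points.
Variables (x y : 'rV[R]_n) (a b T : R) (f df : R -> R).
Hypothesis Ox : Omega x.
Hypothesis Oy : Omega y.
Hypothesis fD : forall t : R, is_derive t 1 f (df t).
Hypothesis cdf : continuous df.
Hypothesis K_le : forall (xi : 'rV[R]_n) (t : R),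
  Omega (x + xi) -> Omega (y + xi) -> 0 < t < T ->
  a * K_ext (x + xi, t) + b * K_ext (y + xi, t) <=
  df t + f t - (a * zero_ext (x + xi, t) + b * zero_ext (y + xi, t)).

Let V (p : rvR) : R := a * zero_ext (x + p.1, p.2) + b * zero_ext (y + p.1, p.2).

(** Testing with [exp t * theta t] instead of [theta t] absorbs the zeroth order
    term [- u] of the operator, and integration by parts moves the derivative of
    [f] onto [theta]. *)
Lemma weak_comparison (r s1 s2 : R) (theta : R -> R) :
  0 < r -> box x r `<=` Omega -> box y r `<=` Omega -> 0 < s1 -> s2 < T ->
  smooth theta -> (forall t, 0 <= theta t) ->
  (forall t, ~ `[s1, s2]%classic t -> theta t = 0) ->
  0 <= \int[vol]_p ((V p - f p.2) * expR p.2 * (box_bump 0 r p.1 * 'D_1 theta p.2)).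
Proof.
move=> r0 xO yO s10 s2T stheta theta_ge0 theta0.
pose psi t := expR t * theta t.
have dtheta (t : R) : is_derive t 1 theta ('D_1 theta t).
  by apply: DeriveDef => //; exact: ((stheta 1).2 1).1.
have cdtheta : continuous ('D_1 theta) by exact: ((stheta 1).2 1).2.
have dtheta0 := derive_supported theta0.
have spsi : smooth psi by move=> k; apply: CkM => //; exact: smooth_expR.
have psi0 t : ~ `[s1, s2]%classic t -> psi t = 0.
  by move=> h; rewrite /psi theta0// mulr0.
have dpsi0 := derive_supported psi0.
have cpsi : continuous psi by exact: spsi 0.
have cdpsi : continuous ('D_1 psi) by exact: ((spsi 1).2 1).2.
have dpsi (t : R) : is_derive t 1 psi ('D_1 psi t).
  by apply: DeriveDef => //; exact: ((spsi 1).2 1).1.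
have dpsiE (t : R) : 'D_1 psi t = expR t * 'D_1 theta t + psi t.
  have [_ ->] := is_deriveM (is_derive_expR t) (dtheta t).
  by rewrite /psi -![_ *: _]/(_ * _) [theta t * _]mulrC.
have cf := is_derive_continuous fD.
pose fpsi t := f t * psi t.
pose dfpsi t := f t * 'D_1 psi t + psi t * df t.
have fpsiD (t : R) : is_derive t 1 fpsi (dfpsi t) by exact: is_deriveM.
have fpsi0 t : ~ `[s1, s2]%classic t -> fpsi t = 0.
  by move=> h; rewrite /fpsi psi0// mulr0.
have dfpsi0 t : ~ `[s1, s2]%classic t -> dfpsi t = 0.
  by move=> h; rewrite /dfpsi psi0// dpsi0// mulr0 mul0r addr0.
have cdfpsi : continuous dfpsi.
  move=> t; apply: cvgD; apply: cvgM;
    [exact: cf|exact: cdpsi|exact: cpsi|exact: cdf].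
pose g t := (df t + f t) * psi t.
have cg : continuous g.
  by move=> t; apply: cvgM; [apply: cvgD; [exact: cdf|exact: cf]|exact: cpsi].
have g0 t : ~ `[s1, s2]%classic t -> g t = 0.
  by move=> h; rewrite /g psi0// mulr0.
have bue z := bounded_measurable_shift z bounded_measurable_zero_ext.
have bKe z := bounded_measurable_shift z bounded_measurable_K_ext.
have bone := bounded_measurable_cst n (1 : R).
have wx := weak_formulation_at r0 xO s10 spsi psi0.
have wy := weak_formulation_at r0 yO s10 spsi psi0.
have ibp := @Rintegral_bump_derivative R n r fpsi dfpsi s1 s2 r0 fpsiD cdfpsi fpsi0 dfpsi0.
pose X (p : rvR) := box_bump 0 r p.1.
pose A (p : rvR) := a * (zero_ext (x + p.1, p.2) * (X p * 'D_1 psi p.2)) +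
  b * (zero_ext (y + p.1, p.2) * (X p * 'D_1 psi p.2)).
pose K (p : rvR) := a * (K_ext (x + p.1, p.2) * (X p * psi p.2)) +
  b * (K_ext (y + p.1, p.2) * (X p * psi p.2)).
pose N (p : rvR) := 1 * (1 * (X p * g p.2)) +
  (-1) * (a * (zero_ext (x + p.1, p.2) * (X p * psi p.2)) +
  b * (zero_ext (y + p.1, p.2) * (X p * psi p.2))).
have iA : vol.-integrable setT (EFin \o A).
  by apply: integrable_lincomb; apply: (integrable_against_bump r0 _ cdpsi dpsi0).
have iK : vol.-integrable setT (EFin \o K).
  by apply: integrable_lincomb; apply: (integrable_against_bump r0 _ cpsi psi0).
have iN : vol.-integrable setT (EFin \o N).
  apply: integrable_lincomb; first exact: (integrable_against_bump r0 bone cg g0).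
  by apply: integrable_lincomb; apply: (integrable_against_bump r0 _ cpsi psi0).
have iD : vol.-integrable setT (EFin \o (fun p => 1 * (X p * dfpsi p.2))).
  exact: (integrable_against_bump r0 bone cdfpsi dfpsi0).
have AK : \int[vol]_p A p = - \int[vol]_p K p.
  rewrite !Rintegral_lincomb//; do ?exact: (integrable_against_bump r0 _ cpsi psi0);
    do ?exact: (integrable_against_bump r0 _ cdpsi dpsi0).
  by rewrite -wx -wy; ring.
have KN : \int[vol]_p K p <= \int[vol]_p N p.
  apply: le_Rintegral => // p _; rewrite /K /N mul1r mulN1r mul1r.
  have [hX|hX] := pselect (box 0 r p.1); last first.
    by rewrite /X box_bump_eq0// !mul0r !mulr0 addr0 subrr.
  have [ht|ht] := pselect (`[s1, s2]%classic p.2); last first.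
    by rewrite psi0// g0// !mulr0 addr0 subrr.
  have shiftO z : box z r `<=` Omega -> Omega (z + p.1).
    apply; apply/boxE => i; have := (boxE _ _ _).1 hX i.
    by rewrite !mxE addrAC subrr add0r subr0.
  have h0 : 0 < p.2 < T.
    by move: ht; rewrite /= in_itv/= => /andP[h1 h2]; apply/andP; split; lra.
  have Xpsi_ge0 : 0 <= X p * psi p.2.
    by rewrite mulr_ge0 ?box_bump_ge0// mulr_ge0// expR_ge0.
  have := ler_wpM2r Xpsi_ge0 (K_le (shiftO _ xO) (shiftO _ yO) h0).
  by congr (_ <= _); rewrite /g; ring.
have <- : \int[vol]_p (1 * (1 * A p + 1 * N p) + (-1) * (1 * (X p * dfpsi p.2))) =
    \int[vol]_p ((V p - f p.2) * expR p.2 * (box_bump 0 r p.1 * 'D_1 theta p.2)).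
  apply: eq_Rintegral => p _.
  by rewrite /A /N /dfpsi /g /V /X dpsiE; ring.
rewrite Rintegral_lincomb//; last exact: integrable_lincomb.
rewrite Rintegral_lincomb//.
rewrite (_ : (\int[vol]_p (1 * (X p * dfpsi p.2))) = 0).
  by rewrite AK mulr0 addr0 !mul1r addrC subr_ge0.
by rewrite -[RHS]ibp; apply: eq_Rintegral => p _; rewrite mul1r.
Qed.

Let w (p : 'rV[R]_n * R) : R :=
  (a * u (x + p.1, p.2) + b * u (y + p.1, p.2) - f p.2) * expR p.2.

Lemma continuous_at_translate (z : 'rV[R]_n) (t : R) : Omega z -> 0 < t ->
  {for (0, t), continuous (fun p : 'rV[R]_n * R => u (z + p.1, p.2))}.
Proof.
move=> Oz t0.
apply: (@continuous_comp _ _ _ (fun p : 'rV[R]_n * R => (z + p.1, p.2)) u).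
  rewrite (_ : (fun p => _) = fun p : 'rV[R]_n * R => (z, 0) + p).
    by apply: cvgD; [exact: cvg_cst|exact: cvg_id].
  by apply/funext => -[p s]; congr pair; rewrite add0r.
rewrite /= addr0; apply: continuous_in_cylinder.
by apply/mem_set; split=> //=; rewrite in_itv/= andbT.
Qed.

Lemma continuous_at_w (t : R) : 0 < t -> {for (0, t), continuous w}.
Proof.
move=> t0.
have csnd (g : R -> R) : continuous g ->
    {for (0, t), continuous (fun p : 'rV[R]_n * R => g p.2)}.
  by move=> cg; apply: (@continuous_comp _ _ _ snd g); [exact: cvg_snd|exact: cg].
apply: cvgM; last exact: (csnd expR (@continuous_expR R)).
apply: cvgB; last exact: (csnd f (is_derive_continuous fD)).
by apply: cvgD; (apply: cvgM; [exact: cvg_cst|exact: continuous_at_translate]).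
Qed.

(** If [w] increased from [t1] to [t2], continuity would keep [w] below [c1] near
    [(0, t1)] and above [c2 > c1] near [(0, t2)]; a plateau concentrated enough
    then makes the integral of [weak_comparison] negative. *)
Lemma comparison_nonincreasing (t1 t2 : R) : 0 < t1 -> t1 < t2 -> t2 < T ->
  w (0, t2) <= w (0, t1).
Proof.
move=> t10 t12 t2T; rewrite leNgt; apply/negP => w12.
pose d := w (0, t2) - w (0, t1).
have d0 : 0 < d by rewrite subr_gt0.
pose c1 := w (0, t1) + d / 3; pose c2 := w (0, t2) - d / 3.
have c12 : c1 < c2 by rewrite /c1 /c2 /d; lra.
have t20 : 0 < t2 by exact: lt_trans t12.
have n1 : nbhs ((0, t1) : 'rV[R]_n * R) [set p | w p < c1].
  by apply: cvgr_lt (continuous_at_w t10) _ _; rewrite /c1; lra.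
have n2 : nbhs ((0, t2) : 'rV[R]_n * R) [set p | c2 < w p].
  by apply: cvgr_gt (continuous_at_w t20) _ _; rewrite /c2; lra.
have [e1 e10 P1] := nbhs_box_pair n1.
have [e2 e20 P2] := nbhs_box_pair n2.
have [e3 e30 P3] := nbhs_box (open_nbhs_nbhs (conj Omega_open Ox)).
have [e4 e40 P4] := nbhs_box (open_nbhs_nbhs (conj Omega_open Oy)).
have [h [h0 he1 he2 he3 [he4 hT]]] : exists h, [/\ 0 < h, h < e1, h < e2, h < e3
    & h < e4 /\ t2 + h < T].
  pose m := Num.min (Num.min (Num.min e1 e2) (Num.min e3 e4)) (T - t2).
  have m0 : 0 < m by rewrite !lt_min e10 e20 e30 e40 subr_gt0.
  have hm : m / 2 < m by lra.
  have : m <= m by [].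
  rewrite {2}/m !le_min -!andbA => /and5P[m1 m2 m3 m4 m5].
  by exists (m / 2); split; [..|split]; lra.
pose s1 := step_pulse h t1; pose s2 := step_pulse h t2.
pose X (p : rvR) := box_bump 0 h p.1.
have := weak_comparison h0
  (P3 _ he3) (P4 _ he4) t10 hT (@smooth_plateau R t1 t2 h)
  (plateau_ge0 h0 t12) (@plateau_eq0 R t1 t2 h h0 t12).
apply/negP; rewrite -ltNge.
have s1_0 := @step_pulse_eq0 R h h0 t1.
have s2_0 := @step_pulse_eq0 R h h0 t2.
have i1 : vol.-integrable setT (EFin \o (fun p => 1 * (X p * s1 p.2))).
  exact: (integrable_against_bump h0 (bounded_measurable_cst n 1)
    (@continuous_step_pulse R h t1) s1_0).
have i2 : vol.-integrable setT (EFin \o (fun p => 1 * (X p * s2 p.2))).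
  exact: (integrable_against_bump h0 (bounded_measurable_cst n 1)
    (@continuous_step_pulse R h t2) s2_0).
have J1 : 0 < \int[vol]_p (1 * (X p * s1 p.2)).
  under eq_Rintegral do rewrite mul1r.
  exact: Rintegral_bump_pulse_gt0.
have dpl (s : R) : 'D_1 (plateau t1 t2 h) s = s1 s - s2 s.
  exact: derive_plateau.
have spl := @smooth_plateau R t1 t2 h.
have cdpl : continuous ('D_1 (plateau t1 t2 h)) by exact: ((spl 1).2 1).2.
have dpl0 := derive_supported (@plateau_eq0 R t1 t2 h h0 t12).
(* both pulses carry the same mass, their difference being a derivative *)
have J12 : 1 * \int[vol]_p (1 * (X p * s1 p.2)) +
    (-1) * \int[vol]_p (1 * (X p * s2 p.2)) = 0.
  rewrite -Rintegral_lincomb//.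
  rewrite -[RHS](@Rintegral_bump_derivative R n h (plateau t1 t2 h)
    ('D_1 (plateau t1 t2 h)) t1 (t2 + h) h0)//.
  - by apply: eq_Rintegral => p _; rewrite dpl /X; ring.
  - move=> t; apply: DeriveDef => //; exact: ((spl 1).2 1).1.
  - exact: plateau_eq0.
apply: (@le_lt_trans _ _ (\int[vol]_p
    (c1 * (1 * (X p * s1 p.2)) + (- c2) * (1 * (X p * s2 p.2))))); last first.
  rewrite Rintegral_lincomb//.
  set j1 := Rintegral _ _ _ in J1 J12 *; set j2 := Rintegral _ _ _ in J12 *.
  have -> : j2 = j1 by move: J12; lra.
  by rewrite -mulrDl pmulr_llt0// subr_lt0.
have bue z := bounded_measurable_shift z bounded_measurable_zero_ext.
apply: le_Rintegral => //; last 2 first.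
- exact: integrable_lincomb.
- move=> p _.
  have [hX|hX] := pselect (box 0 h p.1); last first.
    by rewrite /X box_bump_eq0// !(mul0r, mulr0, addr0).
  have shiftO z : box z h `<=` Omega -> Omega (z + p.1).
    apply; apply/boxE => i; have := (boxE _ _ _).1 hX i.
    by rewrite !mxE addrAC subrr add0r subr0.
  have X0 : 0 <= X p by exact: box_bump_ge0.
  rewrite dpl.
  have wE : 0 < p.2 -> (a * zero_ext (x + p.1, p.2) + b * zero_ext (y + p.1, p.2) - f p.2) *
      expR p.2 = w p.
    move=> p0; rewrite /w !zero_extE//; split=> /=; rewrite ?in_itv/= ?p0//.
      exact: shiftO (P4 _ he4).
    exact: shiftO (P3 _ he3).
  have b1 : (a * zero_ext (x + p.1, p.2) + b * zero_ext (y + p.1, p.2) - f p.2) *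
      expR p.2 * (X p * s1 p.2) <= c1 * (X p * s1 p.2).
    have [ht|ht] := pselect (`[t1, t1 + h]%classic p.2); last first.
      by rewrite /s1 s1_0// !mulr0.
    move: ht; rewrite /= in_itv/= => /andP[ht1 ht2].
    rewrite wE ?(lt_le_trans t10)//.
    apply: ler_wpM2r; first by rewrite mulr_ge0 ?step_pulse_ge0.
    apply: ltW; rewrite [p]surjective_pairing; apply: (P1 _ he1) => //.
    by rewrite ger0_norm ?subr_ge0// lerBlDl.
  have b2 : c2 * (X p * s2 p.2) <= (a * zero_ext (x + p.1, p.2) +
      b * zero_ext (y + p.1, p.2) - f p.2) * expR p.2 * (X p * s2 p.2).
    have [ht|ht] := pselect (`[t2, t2 + h]%classic p.2); last first.
      by rewrite /s2 s2_0// !mulr0.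
    move: ht; rewrite /= in_itv/= => /andP[ht1 ht2].
    rewrite wE ?(lt_le_trans t20)//.
    apply: ler_wpM2r; first by rewrite mulr_ge0 ?step_pulse_ge0.
    apply: ltW; rewrite [p]surjective_pairing; apply: (P2 _ he2) => //.
    by rewrite ger0_norm ?subr_ge0// lerBlDl.
  by rewrite !mul1r mulrBr mulrBr mulNr; apply: lerB.
- pose g t := expR t * 'D_1 (plateau t1 t2 h) t.
  pose k t := f t * g t.
  have cf := is_derive_continuous fD.
  have cg : continuous g by move=> t; apply: cvgM; [exact: continuous_expR|exact: cdpl].
  have ck : continuous k by move=> t; apply: cvgM; [exact: cf|exact: cg].
  have g0 t : ~ `[t1, t2 + h]%classic t -> g t = 0.
    by move=> ht; rewrite /g dpl0// mulr0.
  have k0 t : ~ `[t1, t2 + h]%classic t -> k t = 0.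
    by move=> ht; rewrite /k g0// mulr0.
  have ig z := integrable_against_bump h0 (bue z) cg g0.
  have ik := integrable_against_bump h0 (bounded_measurable_cst n (1 : R)) ck k0.
  have := integrable_lincomb 1 (-1) (integrable_lincomb a b (ig x) (ig y)) ik.
  apply: eq_integrable => // p _ /=; congr EFin; rewrite /k /g /V; ring.
Qed.

End two_points.

Lemma cvg_initial (x : 'rV[R]_n) : Omega x ->
  (fun s => u (x, s)) @ 0^'+ --> u (x, 0).
Proof.
move=> Ox; have [cu _] := uCb.
have Dx0 : (closure Omega `*` `[0, +oo[) (x, 0 : R).
  by split=> /=; [exact: subset_closure|rewrite in_itv/= lexx].
move=> A /((subspace_continuousP _ _).1 cu _ Dx0).
move=> /nbhs_ballP[e /= e0 eA].
rewrite /nbhs/=; near=> s.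
apply: (eA (x, s)); last first.
  split=> /=; first exact: subset_closure.
  by rewrite in_itv/= andbT ltW//; near: s; exact: nbhs_right_gt.
split; first exact: ballxx.
rewrite -ball_normE /= sub0r normrN gtr0_norm; last first.
  by near: s; exact: nbhs_right_gt.
by near: s; exact: nbhs_right_lt.
Unshelve. all: by end_near. Qed.

(** Letting [t1] tend to 0 in [comparison_nonincreasing]. *)
Lemma comparison (x y : 'rV[R]_n) (a b T : R) (f df : R -> R) :
  Omega x -> Omega y ->
  (forall t : R, is_derive t 1 f (df t)) -> continuous df ->
  (forall (xi : 'rV[R]_n) (t : R),
    Omega (x + xi) -> Omega (y + xi) -> 0 < t < T ->
    a * mu_average (x + xi, t) + b * mu_average (y + xi, t) <= df t + f t) ->
  forall t, 0 < t < T ->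
  (a * u (x, t) + b * u (y, t) - f t) * expR t <=
  a * u (x, 0) + b * u (y, 0) - f 0.
Proof.
move=> Ox Oy fD cdf avg_le t /andP[t0 tT].
have K_le (xi : 'rV[R]_n) (s : R) : Omega (x + xi) -> Omega (y + xi) -> 0 < s < T ->
    a * K_ext (x + xi, s) + b * K_ext (y + xi, s) <=
    df s + f s - (a * zero_ext (x + xi, s) + b * zero_ext (y + xi, s)).
  move=> h1 h2 h3; have := avg_le xi s h1 h2 h3; rewrite /K_ext; lra.
have mono := comparison_nonincreasing Ox Oy fD cdf K_le.
pose q s := (a * u (x, s) + b * u (y, s) - f s) * expR s.
have cq : q @ 0^'+ --> a * u (x, 0) + b * u (y, 0) - f 0.
  have -> : a * u (x, 0) + b * u (y, 0) - f 0 =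
      (a * u (x, 0) + b * u (y, 0) - f 0) * expR 0 by rewrite expR0 mulr1.
  apply: cvgM; last by apply: cvg_at_right_filter; exact: continuous_expR.
  apply: cvgB; last by apply: cvg_at_right_filter; exact: (is_derive_continuous fD).
  by apply: cvgD; apply: cvgMl_tmp; exact: cvg_initial.
rewrite -(cvg_lim _ cq)//; apply: limr_ge; first by apply/cvg_ex; eexists; exact: cq.
near=> s.
have s0 : 0 < s by near: s; exact: nbhs_right_gt.
have st : s < t by near: s; exact: nbhs_right_lt.
by have := mono s t s0 st tT; rewrite /= !addr0.
Unshelve. all: by end_near. Qed.

(** If [|u| <= M + D] up to time [T] then the constant [M + D] is a supersolution,
    and comparison improves the bound to [M + (1 - exp (- T)) D]. *)
Lemma maximum_principle (M : R) : 0 <= M ->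
  (forall x, Omega x -> `|u (x, 0)| <= M) ->
  forall x t, Omega x -> 0 < t -> `|u (x, t)| <= M.
Proof.
move=> M0 u0M x t Ox t0.
have [C C0 uC] := bounded_sol.
pose T := t + 1; pose q := 1 - expR (- T).
have q01 : 0 <= q < 1.
  rewrite /q subr_ge0 expR_le1 ltrBlDr ltrDl expR_gt0 andbT oppr_le0.
  by rewrite addr_ge0// ltW.
apply: (@geometric_improvement R ('rV[R]_n * R)
  (fun p => Omega p.1 /\ 0 < p.2 < T) (fun p => `|u p|) (fun=> M) q C q01 C0
  _ _ (x, t)).
- move=> [z s] [/= Oz /andP[s0 _]]; apply: (le_trans (uC z s Oz (ltW s0))).
  by rewrite lerDr.
- move=> D D0 uD [z s] [/= Oz /[dup] sT /andP[s0 sT']].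
  have MD0 : 0 <= M + D by rewrite addr_ge0.
  have ueD z' s' : 0 < s' < T -> `|zero_ext (z', s')| <= M + D.
    move=> hs'; have [cz|cz] := pselect (cylinder (z', s')); last first.
      by rewrite zero_ext_out// normr0.
    by rewrite zero_extE//; apply: uD; split => //; exact: cz.1.
  have signed (sg : R) : `|sg| = 1 -> sg * u (z, s) <= M + q * D.
    move=> sg1.
    have sg_le v c : `|v| <= c -> sg * v <= c.
      by move=> vc; apply: le_trans (ler_norm _) _; rewrite normrM sg1 mul1r.
    have avg_le (xi : 'rV[R]_n) s' : Omega (z + xi) -> Omega (z + xi) -> 0 < s' < T ->
        sg * mu_average (z + xi, s') + 0 * mu_average (z + xi, s') <= 0 + (M + D).
      move=> _ _ hs'; rewrite mul0r addr0 add0r.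
      by apply/sg_le/mu_average_bound => z'; exact: ueD.
    have h := @comparison z z sg 0 T (fun=> M + D) (fun=> 0) Oz Oz
      (fun t => is_derive_cst _ _ _) (@cst_continuous R R 0) avg_le s sT.
    rewrite !mul0r !addr0 in h.
    have h0 := sg_le _ _ (u0M _ Oz).
    have {h h0} h : (sg * u (z, s) - (M + D)) * expR s <= - D by lra.
    have e : sg * u (z, s) - (M + D) <= - D * expR (- s).
      by rewrite expRN ler_pdivlMr ?expR_gt0.
    have e2 : D * expR (- T) <= D * expR (- s).
      by rewrite ler_wpM2l// ler_expR lerN2 ltW.
    rewrite /q; lra.
  rewrite ler_norml; apply/andP; split.
    by have := signed (-1); rewrite normrN1 mulN1r => /(_ erefl); lra.
  by have := signed 1; rewrite normr1 mul1r => /(_ erefl).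
- by split => //=; rewrite /T; apply/andP; split; lra.
Qed.

(** * The modulus of continuity *)

Lemma measurable_translate (x : 'rV[R]_n) : measurable (translate Omega x).
Proof.
have := measurable_shift_rV x measurableT (open_measurable_rV Omega_open).
by rewrite setTI.
Qed.

Lemma integrable_indic_mu (S : set 'rV[R]_n) : measurable S ->
  leb.-integrable setT (EFin \o (fun z => \1_S z * mu z)).
Proof.
move=> mS; apply: (@integrable_mu_bounded _ 1).
  exact: measurable_indic.
by move=> z; rewrite ger0_norm// indicE; case: (_ \in _).
Qed.

Lemma density_measureE (S : set 'rV[R]_n) :
  density_measure mu S = \int[leb]_z (\1_S z * mu z).
Proof.
rewrite /density_measure Rintegral_mkcond; apply: eq_Rintegral => z _.
by rewrite patchE indicE; case: (_ \in _); rewrite ?mul1r ?mul0r.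
Qed.

Lemma density_measure_ge0 (S : set 'rV[R]_n) : 0 <= density_measure mu S.
Proof. by apply: Rintegral_ge0 => z _. Qed.

Lemma density_measure_le1 (S : set 'rV[R]_n) : measurable S ->
  density_measure mu S <= 1.
Proof.
move=> mS; rewrite density_measureE -mu_mass1.
apply: le_Rintegral => //; first exact: integrable_indic_mu.
by move=> z _; rewrite indicE; case: (_ \in _); rewrite ?mul1r ?mul0r.
Qed.

(** Split the translated domains into their overlap, where the integrand is a
    difference of two values of [u], and their symmetric difference, where it is
    a single value. *)
Lemma mu_average_sub_le (x y : 'rV[R]_n) (t W M : R) : 0 < t ->
  (forall z, Omega (x + z) -> Omega (y + z) -> u (x + z, t) - u (y + z, t) <= W) ->
  (forall z, Omega z -> `|u (z, t)| <= M) ->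
  mu_average (x, t) - mu_average (y, t) <=
  W * density_measure mu (translate Omega x `&` translate Omega y) +
  M * density_measure mu (translate Omega x `+` translate Omega y).
Proof.
move=> t0 uW uM; set A := translate Omega x; set B := translate Omega y.
have mA : measurable A := measurable_translate x.
have mB : measurable B := measurable_translate y.
have mI : measurable (A `&` B) by exact: measurableI.
have mS : measurable (A `+` B).
  by apply: measurableU; exact: measurableD.
have iI := integrable_indic_mu mI.
have iS := integrable_indic_mu mS.
rewrite !density_measureE -!RintegralZl// -RintegralD//; last 2 first.
- by apply: eq_integrable (integrableZl measurableT W iI).
- by apply: eq_integrable (integrableZl measurableT M iS).
have ix := integrable_mu_average (x, t).
have iy := integrable_mu_average (y, t).
rewrite /mu_average -RintegralB//.
apply: le_Rintegral => //.
- by apply: eq_integrable (integrableB measurableT ix iy).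
- by apply: eq_integrable (integrableD measurableT
    (integrableZl measurableT W iI) (integrableZl measurableT M iS)).
move=> z _ /=; rewrite -mulrBl !mulrA -mulrDl ler_wpM2r// !indicE.
have inA : zero_ext (x + z, t) = if z \in A then u (x + z, t) else 0.
  case: ifPn => [/set_mem zA|/negP zA].
    by rewrite zero_extE//; split => //=; rewrite in_itv/= andbT.
  by rewrite zero_ext_out// => -[h _]; apply/zA/mem_set.
have inB : zero_ext (y + z, t) = if z \in B then u (y + z, t) else 0.
  case: ifPn => [/set_mem zB|/negP zB].
    by rewrite zero_extE//; split => //=; rewrite in_itv/= andbT.
  by rewrite zero_ext_out// => -[h _]; apply/zB/mem_set.
rewrite inA inB in_setI in_setU !in_setD.
have [/set_mem zA|zA] := boolP (z \in A); have [/set_mem zB|zB] := boolP (z \in B);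
  rewrite /= ?(mulr1, mulr0, addr0, add0r, subr0, sub0r, subrr)//.
- exact: uW.
- by apply: le_trans (ler_norm _) _; exact: uM.
- by apply: le_trans (ler_norm _) _; rewrite normrN; exact: uM.
Qed.

Section modulus.
Variables (eta l g M : R) (w : R -> R).
Hypothesis M_ge0 : 0 <= M.
Hypothesis u0M : forall x, Omega x -> `|u (x, 0)| <= M.
Hypothesis l_le1 : l <= 1.
Hypothesis overlap_le : forall x y, close_pair Omega eta x y ->
  density_measure mu (translate Omega x `&` translate Omega y) <= l.
Hypothesis diff_le : forall x y, close_pair Omega eta x y ->
  density_measure mu (translate Omega x `+` translate Omega y) <= g.
Hypothesis w_ge0 : forall t, 0 <= t -> 0 <= w t.
Hypothesis w_ode : forall t : R, is_derive t 1 w ((l - 1) * w t + g * M).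
Hypothesis w_init : forall x y, close_pair Omega eta x y ->
  `|u (x, 0) - u (y, 0)| <= w 0.

Lemma close_pairC x y : close_pair Omega eta x y -> close_pair Omega eta y x.
Proof.
case=> Ox Oy xy; split=> //; congr (_ < _): xy; congr Num.sqrt.
by apply: eq_bigr => i _; rewrite !mxE -sqrrN opprB.
Qed.

(** If differences are at most [w + D] up to time [T], then [w + l D] is a
    supersolution of their evolution, so that comparison improves the error [D]
    by the factor [1 - exp (- T)]. *)
Lemma modulus_bound x y t : close_pair Omega eta x y -> 0 < t ->
  `|u (x, t) - u (y, t)| <= w t.
Proof.
move=> xy t0.
have [C C0 uC] := bounded_sol.
have uM := maximum_principle M_ge0 u0M.
have l_ge0 : 0 <= l by apply: le_trans (overlap_le xy); exact: density_measure_ge0.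
pose T := t + 1; pose q := 1 - expR (- T).
have q01 : 0 <= q < 1.
  rewrite /q subr_ge0 expR_le1 ltrBlDr ltrDl expR_gt0 andbT oppr_le0.
  by rewrite addr_ge0// ltW.
have cw := is_derive_continuous w_ode.
suff half : u (x, t) - u (y, t) <= w t /\ u (y, t) - u (x, t) <= w t.
  by rewrite ler_norml; apply/andP; split; lra.
suff H : forall i : 'rV[R]_n * 'rV[R]_n * R,
    close_pair Omega eta i.1.1 i.1.2 /\ 0 < i.2 < T ->
    u (i.1.1, i.2) - u (i.1.2, i.2) <= w i.2.
  have tT : 0 < t < T by rewrite /T; apply/andP; split; lra.
  split; first exact: (H (x, y, t) (conj xy tT)).
  exact: (H (y, x, t) (conj (close_pairC xy) tT)).
apply: (@geometric_improvement R _ _ (fun i => u (i.1.1, i.2) - u (i.1.2, i.2))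
  (fun i => w i.2) q (C + C) q01); first by rewrite addr_ge0.
- move=> [[x' y'] s] [/= [Ox Oy _] /andP[s0 _]].
  have := uC x' s Ox (ltW s0); have := uC y' s Oy (ltW s0).
  have := w_ge0 (ltW s0); rewrite !ler_norml => h /andP[h1 h2] /andP[h3 h4]; lra.
move=> D D0 uD [[x' y'] s] [/= cxy /[dup] sT /andP[s0 sT']].
have [Ox Oy dxy] := cxy.
pose f r := w r + l * D.
pose df r := (l - 1) * w r + g * M.
have fD (r : R) : is_derive r 1 f (df r).
  by apply: is_derive_eq (is_deriveD (w_ode r) (is_derive_cst (l * D) r 1)) _;
    rewrite addr0.
have cdf : continuous df.
  move=> r; apply: cvgD; last exact: cvg_cst.
  by apply: cvgMl_tmp; exact: cw.
have avg_le (xi : 'rV[R]_n) r : Omega (x' + xi) -> Omega (y' + xi) -> 0 < r < T ->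
    1 * mu_average (x' + xi, r) + (-1) * mu_average (y' + xi, r)
    <= df r + f r.
  move=> Ox' Oy' /[dup] hr /andP[r0 rT].
  have shift_sub (z : 'rV[R]_n) : x' + z - (y' + z) = x' - y'.
    by rewrite opprD addrACA subrr addr0.
  have cxi : close_pair Omega eta (x' + xi) (y' + xi) by split=> //; rewrite shift_sub.
  have := @mu_average_sub_le (x' + xi) (y' + xi) r (w r + D) M r0.
  rewrite mul1r mulN1r => h; apply: le_trans (h _ _) _.
  - move=> z Ox'' Oy''; apply: (uD (x' + xi + z, y' + xi + z, r)); split => //.
    by split => //=; rewrite -![_ + xi + z]addrA shift_sub.
  - by move=> z Oz; exact: uM.
  - have W0 : 0 <= w r + D by rewrite addr_ge0// w_ge0// ltW.
    have h1 := ler_wpM2l W0 (overlap_le cxi).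
    have h2 := ler_wpM2l M_ge0 (diff_le cxi).
    rewrite /df /f; lra.
have := @comparison x' y' 1 (-1) T f df Ox Oy fD cdf avg_le s sT.
rewrite !mul1r !mulN1r => h.
have h0 : u (x', 0) - u (y', 0) <= w 0.
  by apply: le_trans (ler_norm _) _; exact: w_init.
have {h h0} h : (u (x', s) - u (y', s) - f s) * expR s <= - (l * D).
  by apply: le_trans h _; rewrite /f; lra.
have e : u (x', s) - u (y', s) - f s <= - (l * D) * expR (- s).
  by rewrite expRN ler_pdivlMr ?expR_gt0.
have eT : expR (- T) <= expR (- s) by rewrite ler_expR lerN2 ltW.
have es : expR (- s) <= 1 by rewrite expR_le1 oppr_le0 ltW.
have e2 : l * D * (1 - expR (- s)) <= D * (1 - expR (- T)).
  apply: ler_pM; rewrite ?mulr_ge0 ?subr_ge0//; last by rewrite lerB.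
  by rewrite ler_piMl.
move: e; rewrite /q /f; lra.
Qed.

End modulus.

End dirichlet.

(** * The theorem *)

Lemma supnorm_ge0 (R : realType) n (Omega : set 'rV[R]_n) (u0 : 'rV[R]_n -> R) :
  0 <= supnorm Omega u0.
Proof. by apply: sup_nonneg => _ [x _ <-]. Qed.

Lemma supnorm_ub (R : realType) n (Omega : set 'rV[R]_n) (u0 : 'rV[R]_n -> R) C :
  open Omega -> (forall x, boundary Omega x -> u0 x = 0) -> 0 <= C ->
  (forall x, Omega x -> `|u0 x| <= C) ->
  forall x, Omega x -> `|u0 x| <= supnorm Omega u0.
Proof.
move=> oO u00 C0 u0C x Ox; apply: ub_le_sup; last first.
  by exists x => //; exact: subset_closure.
exists C => _ [y cy <-].
have [Oy|nOy] := pselect (Omega y); first exact: u0C.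
rewrite u00 ?normr0//; split=> // /interior_subset; exact: nOy.
Qed.

Theorem theorem5p2 (R : realType) (n : nat) (n_gt0 : (0 < n)%N)
    (Omega : set 'rV[R]_n)
    (Omega_open : open Omega)
    (Omega_bounded : bounded_set Omega)
    (Omega_connected : connected Omega)
    (Omega_smooth : smooth_boundary Omega)
    (mu : 'rV[R]_n -> R)
    (mu_ge0 : forall z, 0 <= mu z)
    (mu_L1 : (lebesgue_rV R n).-integrable setT (fun z => (mu z)%:E))
    (mu_mass1 : (\int[lebesgue_rV R n]_z mu z) = 1)
    (u0 : 'rV[R]_n -> R) (u0_C0 : C0_closure Omega u0)
    (u : 'rV[R]_n * R -> R) (u_sol : dirichlet_solution Omega mu u0 u)
    (eta : R) (eta_gt0 : 0 < eta) :
  (lambda Omega mu eta < 1 ->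
    forall t : R, 0 < t ->
      omega Omega u eta t <=
        (omega0 Omega u0 eta +
         gamma Omega mu eta * supnorm Omega u0 *
           ((expR ((1 - lambda Omega mu eta) * t) - 1) /
            (1 - lambda Omega mu eta))) *
        expR ((lambda Omega mu eta - 1) * t)) /\
  (lambda Omega mu eta = 1 ->
    forall t : R, 0 < t ->
      omega Omega u eta t <=
        omega0 Omega u0 eta + gamma Omega mu eta * supnorm Omega u0 * t).
Proof.
have [uCb uK ui] := u_sol.
set l := lambda Omega mu eta; set g := gamma Omega mu eta.
set M := supnorm Omega u0; set w0 := omega0 Omega u0 eta.
have [C C0 uC] := bounded_sol uCb.
have u0C x : Omega x -> `|u0 x| <= C by move=> Ox; rewrite -ui//; exact: uC.
have M0 : 0 <= M by exact: supnorm_ge0.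
have u0M x : Omega x -> `|u (x, 0)| <= M.
  by move=> Ox; rewrite ui//; exact: (supnorm_ub Omega_open u0_C0.2 C0).
have w0_ge0 : 0 <= w0 by exact: sup_close_ge0.
have g_ge0 : 0 <= g by apply: sup_close_ge0 => x y; exact: density_measure_ge0.
have gM0 : 0 <= g * M by exact: mulr_ge0.
have mtr x := measurable_translate Omega_open x.
have overlap_le x y : close_pair Omega eta x y ->
    density_measure mu (translate Omega x `&` translate Omega y) <= l.
  apply: (@sup_close_ub _ _ _ _ _ 1) => x' y' _ _.
  by apply: density_measure_le1 => //; exact: measurableI.
have diff_le x y : close_pair Omega eta x y ->
    density_measure mu (translate Omega x `+` translate Omega y) <= g.
  apply: (@sup_close_ub _ _ _ _ _ 1) => x' y' _ _.
  by apply: density_measure_le1 => //; apply: measurableU; exact: measurableD.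
have w_init x y : close_pair Omega eta x y -> `|u (x, 0) - u (y, 0)| <= w0.
  move=> /[dup] -[Ox Oy _]; rewrite !ui//.
  apply: (@sup_close_ub _ _ _ _ (fun x y => `|u0 x - u0 y|) (C + C)) => x' y' Ox' Oy'.
  by apply: le_trans (ler_normB _ _) _; apply: lerD; exact: u0C.
(* Both estimates are explicit solutions of w' = (l - 1) w + g M, w 0 = w0. *)
have bound (w : R -> R) : l <= 1 -> w 0 = w0 -> (forall t, 0 <= t -> 0 <= w t) ->
    (forall t : R, is_derive t 1 w ((l - 1) * w t + g * M)) ->
    forall t, 0 < t -> omega Omega u eta t <= w t.
  move=> l1 w00 wge0 wD t t0.
  apply: sup_close_le => [|x y xy]; first exact/wge0/ltW.
  apply: (modulus_bound Omega_open mu_ge0 mu_L1 mu_mass1 uCb uK M0 u0M l1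
    overlap_le diff_le wge0 wD _ xy t0).
  by rewrite w00.
split=> [l1 t t0|l1].
- have l1n : 1 - l != 0 by rewrite gt_eqF ?subr_gt0.
  pose w s := (w0 + g * M * ((expR ((1 - l) * s) - 1) / (1 - l))) * expR ((l - 1) * s).
  have wE s : w s = (w0 - g * M / (1 - l)) * expR ((l - 1) * s) + g * M / (1 - l).
    have e : expR ((1 - l) * s) * expR ((l - 1) * s) = 1.
      by rewrite -expRD -mulrDl addrA subrK subrr mul0r expR0.
    rewrite /w -[X in _ = _ + X]mulr1 -[X in _ = _ + _ * X]e; field.
    exact: l1n.
  apply: (bound w (ltW l1)) => //.
  + by rewrite wE mulr0 expR0 mulr1 subrK.
  + move=> s s0; rewrite mulr_ge0 ?expR_ge0// addr_ge0// mulr_ge0// divr_ge0//.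
      by rewrite subr_ge0 -[leLHS](@expR0 R) ler_expR mulr_ge0// subr_ge0 ltW.
    by rewrite subr_ge0 ltW.
  + move=> s; rewrite (funext wE).
    have dE : is_derive s 1 (fun s : R => expR ((l - 1) * s))
        ((l - 1) * expR ((l - 1) * s)).
      have dl : is_derive s 1 (fun s : R => (l - 1) * s) (l - 1).
        by apply: is_derive_eq (is_deriveZ (l - 1) (is_derive_id s 1)) _;
          rewrite -[_ *: _]/(_ * _) mulr1.
      have := @is_derive1_comp _ expR _ s _ _ (is_derive_expR ((l - 1) * s)) dl.
      by rewrite mulrC.
    apply: is_derive_eq (is_deriveD (is_deriveZ (w0 - g * M / (1 - l)) dE)
      (is_derive_cst (g * M / (1 - l)) s 1)) _.
    rewrite -[_ *: _]/(_ * _) addr0; field.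
    exact: l1n.
- pose w s := w0 + g * M * s.
  apply: (bound w); first by rewrite l1.
  + by rewrite /w mulr0 addr0.
  + by move=> s s0; rewrite addr_ge0// mulr_ge0.
  + move=> s; rewrite l1 subrr mul0r add0r.
    apply: is_derive_eq (is_deriveD (is_derive_cst w0 s 1)
      (is_deriveZ (g * M) (is_derive_id s 1))) _.
    by rewrite -[_ *: _]/(_ * _) mulr1 add0r.
Qed.
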